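(* Let $\mathfrak{S}=j^{-1}(0)\cup j^{-1}(1728)=\pi^{-1}(S)$, where $j$ is restricted to $\mathfrak{C}$. Then the restriction $j:\mathfrak{C}\setminus\mathfrak{S}\to\mathbb{C}\setminus\{0,1728\}$ is a surjective submersion. More precisely, outside $\mathfrak{S}$, $j$ defines a fiber bundle over $\mathbb{C}\setminus\{0,1728\}$, the general fiber of which is isomorphic to the disjoint union $\coprod_{i=1}^{4}G/V_4$.
   Context: A conic in $\mathbb{CP}^2$ is identified with its symmetric $3\times 3$ complex matrix up to a non-zero scalar. $\mathfrak{O}\subset\mathbb{CP}^5\times\mathbb{CP}^5$ is the open set of pairs $(C,D)$ of non-degenerate conics that intersect transversely, i.e. in four distinct points. $G=\mathbb{P}GL_3(\mathbb{C})$ acts on $\mathfrak{O}$ by congruence, $(C,D)\mapsto(A^TCA,A^TDA)$; $\pi:\mathfrak{O}\to\mathcal{M}=\mathfrak{O}/G$ is the canonical projection. $V_4\subset G$ is the Klein four-group of classes of the matrices $\operatorname{diag}(a_1,a_2,a_3)$, $a_i\in\{1,-1\}$. The Cayley set $\mathfrak{C}\subset\mathfrak{O}$ is the set of $(C,D)\in\mathfrak{O}$ for which the coefficient $A_2$ of $t^2$ in the Taylor expansion of $\sqrt{\det(tC+D)}$ at $t=0$ vanishes; equivalently $-\sigma_{1,2}^2+4\sigma_{0,3}\sigma_{2,1}=0$ where $\det(tC+D)=\sigma_{3,0}t^3+\sigma_{2,1}t^2+\sigma_{1,2}t+\sigma_{0,3}$; it is a $9$-dimensional complex manifold. For $(C,D)\in\mathfrak{O}$,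 $j(C,D)$ is the j-invariant of the elliptic curve $y^2=\det(xC+D)$, normalized so that $y^2=x^3+ax^2+bx+c$ has j-invariant $-\frac{256(a^2-3b)^3}{4a^3c-a^2b^2-18abc+4b^3+27c^2}$; it factors as $j=\overline{j}\circ\pi$. $S=\{p\in\pi(\mathfrak{C}):\overline{j}(p)\in\{0,1728\}\}$. *)

(* Defs.v *)
From HB Require Import structures.
From mathcomp Require Import all_boot all_order all_algebra.
From mathcomp Require Import complex.
From mathcomp Require Import all_classical all_reals all_analysis.

Set Implicit Arguments.
Unset Strict Implicit.
Unset Printing Implicit Defensive.
Import Order.TTheory GRing.Theory Num.Theory.
Import numFieldNormedType.Exports.
Local Open Scope classical_set_scope.
Local Open Scope ring_scope.

(** * Complex spaces and holomorphic maps

    A [cspace] is a set of points together with a family of parametrizations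
    [cpar i], each defined on an open subset [cdom i] of a normed space.  The
    parametrizations need not be injective: they stand for holomorphic
    submersions onto open subsets, so that projective spaces and quotients of
    groups are parametrized by the vectors, resp. matrices, which represent
    their points.  The complex structure is the one for which every [cpar i]
    is a holomorphic submersion. *)

Record cspace (K : numFieldType) := CSpace {
  cpt :> Type ;
  cmodel : normedModType K ;
  cidx : Type ;
  cdom : cidx -> set cmodel ;
  cpar : cidx -> cmodel -> cpt }.
Arguments CSpace {K cpt cmodel cidx}.
Arguments cdom {K c}.
Arguments cpar {K c}.

Section ComplexSpaces.
Variable K : numFieldType.

(* The quotient (final) topology of the parametrizations. *)
Definition copen (S : cspace K) (O : set S) : Prop :=
  forall i : cidx S, open (cdom i `&` cpar i @^-1` O).

(* Holomorphic maps between subsets: near every point of [X], in coordinates,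
   [f] is the restriction to [X] of a complex-differentiable map of the model
   spaces.  For embedded submanifolds [X] and [X'] this is the usual notion;
   since the parametrizations are submersions, they admit local holomorphic
   sections, so that asking for a local lift of [f] is no restriction. *)
Definition holomorphic (S S' : cspace K) (X : set S) (X' : set S')
    (f : S -> S') : Prop :=
  set_fun X X' f /\
  forall (i : cidx S) (v : cmodel S), cdom i v -> X (cpar i v) ->
    exists (i' : cidx S') (F : cmodel S -> cmodel S'),
      \forall w \near v, differentiable F w /\
        (X (cpar i w) -> cdom i' (F w) /\ cpar i' (F w) = f (cpar i w)).

Definition biholomorphic (S S' : cspace K) (X : set S) (X' : set S')
    (f : S -> S') : Prop :=
  exists g : S' -> S,
    [/\ holomorphic X X' f, holomorphic X' X g,
        forall x, X x -> g (f x) = x & forall y, X' y -> f (g y) = y].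

Definition caffine (V : normedModType K) : cspace K :=
  CSpace (fun _ : unit => [set: V]) (fun _ : unit => @id V).

Definition cprod (S S' : cspace K) : cspace K :=
  CSpace (cpt := (S * S')%type) (cmodel := (cmodel S * cmodel S')%type)
    (fun i : cidx S * cidx S' => cdom i.1 `*` cdom i.2)
    (fun i v => (cpar i.1 v.1, cpar i.2 v.2)).

(* The disjoint union of [k] copies of [S]. *)
Definition ccopies (k : nat) (S : cspace K) : cspace K :=
  CSpace (cpt := ('I_k * S)%type)
    (fun i : 'I_k * cidx S => cdom i.2)
    (fun i v => (i.1, cpar i.2 v)).

Definition cquot (S : cspace K) (T : Type) (q : S -> T) : cspace K :=
  CSpace (fun i : cidx S => cdom i) (fun i v => q (cpar i v)).

(* [X] is a complex submanifold of dimension [n] of [S], and [f], with values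
   in the subset [Y] of [V], has a surjective differential at every point
   of [X], computed in a holomorphic chart [psi^-1] of [X]. *)
Definition submersion (n : nat) (S : cspace K) (V : normedModType K)
    (X : set S) (Y : set V) (f : S -> V) : Prop :=
  holomorphic X (Y : set (caffine V)) f /\
  forall p, X p ->
    exists (O : set S) (W : set 'rV[K]_n) (psi : 'rV[K]_n -> S) (z : 'rV[K]_n),
      [/\ copen O /\ open W,
          W z /\ psi z = p,
          biholomorphic (W : set (caffine 'rV[K]_n)) (X `&` O) psi
        & forall u : V, exists v : 'rV[K]_n, 'd (f \o psi) z v = u].

(* Locally trivial holomorphic bundle [f : X -> B] with fibre [Y]. *)
Definition fiber_bundle (S F : cspace K) (V : normedModType K)
    (X : set S) (B : set V) (Y : set F) (f : S -> V) : Prop :=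
  set_fun X B f /\
  forall b, B b ->
    exists (U : set V) (Phi : S -> cprod (caffine V) F),
      [/\ open U, U b, U `<=` B,
          biholomorphic (X `&` f @^-1` U)
           (U `*` Y : set (cprod (caffine V) F)) Phi
        & forall x, X x -> U (f x) -> (Phi x).1 = f x].

End ComplexSpaces.

(** * Projective spaces of matrices *)

Section Projective.
Variables (K : numFieldType) (m n : nat).

Definition nzmx : choiceType := {M : 'M[K]_(m.+1, n.+1) | M != 0}.

Definition proportional (M N : nzmx) : bool :=
  `[< exists2 c : K, c != 0 & val N = c *: val M >].

Lemma proportional_equiv : equiv_class_of proportional.
Proof.
split=> [M | M N | N M P].
- by apply/asboolP; exists 1; rewrite ?oner_neq0 ?scale1r.
- apply/asboolP/asboolP => -[c c0 E]; exists c^-1; rewrite ?invr_eq0 // E.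
  + by rewrite scalerA mulVf // scale1r.
  + by rewrite scalerA mulVf // scale1r.
- move=> /asboolP[c c0 E] /asboolP[d d0 E']; apply/asboolP.
  by exists (d * c); rewrite ?mulf_neq0 // E' E scalerA.
Qed.
Canonical proportional_equivr := EquivRelPack proportional_equiv.

Definition pspace : choiceType := {eq_quot proportional}%qT.

Lemma ones_neq0 : const_mx 1 != 0 :> 'M[K]_(m.+1, n.+1).
Proof. by apply/eqP => /matrixP/(_ 0 0)/eqP; rewrite !mxE oner_eq0. Qed.

(* The class of [M]; the value at [M = 0] is irrelevant. *)
Definition pclass (M : 'M[K]_(m.+1, n.+1)) : pspace :=
  (\pi_({eq_quot proportional})
    (insubd (exist _ (const_mx 1) ones_neq0 : nzmx) M))%qT.

Definition prep (p : pspace) : 'M[K]_(m.+1, n.+1) := val (repr p : nzmx).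

Definition cproj : cspace K :=
  CSpace (cpt := pspace) (fun _ : unit => [set M | M != 0]) (fun _ => pclass).

End Projective.

(** * Pairs of conics *)

Section Conics.
Variable R : realType.

Definition CC : numFieldType := R[i].

Definition point2 : Type := pspace CC 2 0.

(* The projective space of all non-zero 3 x 3 matrices.  It contains both the
   projective space of conics, as the linear subspace of symmetric matrices,
   and PGL_3, as an open subset. *)
Definition pmx3 : Type := pspace CC 2 2.
Definition cpmx3 : cspace CC := cproj CC 2 2.
Definition pairs : cspace CC := cprod cpmx3 cpmx3.

Definition is_conic (c : pmx3) : Prop := (prep c)^T = prep c.
Definition nondegenerate (c : pmx3) : Prop := \det (prep c) != 0.
Definition on_conic (c : pmx3) (x : point2) : Prop :=
  (prep x)^T *m prep c *m prep x = 0.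

Definition transverse_pairs : set pairs :=
  [set p | [/\ is_conic p.1 /\ is_conic p.2,
               nondegenerate p.1 /\ nondegenerate p.2
             & ([set x | on_conic p.1 x /\ on_conic p.2 x] #= `I_4)%card]].

(* The properties of pairs below are expressed on representatives, but do not
   depend on their choice. *)

Definition taylor_coef (s : CC -> CC) (k : nat) : CC :=
  derive1n k s 0 / k`!%:R.

(* [s] is a holomorphic branch of [sqrt (det (t C + D))] near [t = 0]. *)
Definition sqrt_det_branch (p : pairs) (s : CC -> CC) : Prop :=
  \forall t \near (0 : CC), derivable s t 1 /\
    s t ^+ 2 = \det (t *: prep p.1 + prep p.2).

Definition cayley_set : set pairs :=
  [set p | transverse_pairs p /\
     exists2 s, sqrt_det_branch p s & taylor_coef s 2 = 0].

Definition pencil_det (p : pairs) : {poly CC} :=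
  \det ('X *: map_mx polyC (prep p.1) + map_mx polyC (prep p.2)).

Definition j_weierstrass (a b c : CC) : CC :=
  - (256 * (a ^+ 2 - 3 * b) ^+ 3
     / (4 * a ^+ 3 * c - a ^+ 2 * b ^+ 2 - 18 * a * b * c
        + 4 * b ^+ 3 + 27 * c ^+ 2)).

(* Rescaling [y] turns y^2 = s3 x^3 + s2 x^2 + s1 x + s0 into the isomorphic
   curve y^2 = x^3 + (s2/s3) x^2 + (s1/s3) x + s0/s3. *)
Definition j_inv (p : pairs) : CC :=
  let s := pencil_det p in
  j_weierstrass (s`_2 / s`_3) (s`_1 / s`_3) (s`_0 / s`_3).

Definition PGL3 : set cpmx3 := [set g | \det (prep g) != 0].

Definition pmul (g h : pmx3) : pmx3 := pclass (prep g *m prep h).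

Definition congr_act (g : pmx3) (p : pairs) : pairs :=
  (pclass ((prep g)^T *m prep p.1 *m prep g),
   pclass ((prep g)^T *m prep p.2 *m prep g)).

(* The projection of pairs to the moduli space, whose points are the orbits. *)
Definition orbit_of (p : pairs) : set pairs :=
  [set congr_act g p | g in PGL3].

(* The function induced by [j_inv] on orbits: its value at any point of the
   orbit (the default value is irrelevant, orbits being non-empty). *)
Definition j_bar (o : set (pmx3 * pmx3)) : CC :=
  j_inv (xget (pclass 1%:M, pclass 1%:M) o).

Definition special_moduli : set (set pairs) :=
  [set o | (orbit_of @` cayley_set) o /\ (j_bar o = 0 \/ j_bar o = 1728)].

Definition special_pairs : set pairs :=
  [set p | cayley_set p /\ (j_inv p = 0 \/ j_inv p = 1728)].

Definition V4 : set pmx3 :=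
  [set pclass (diag_mx a) | a in
     [set a : 'rV[CC]_3 | forall i, a 0 i = 1 \/ a 0 i = -1]].

Definition coset_V4 (g : pmx3) : set pmx3 := [set pmul g a | a in V4].

(* The points of [cG_V4] which are not in [G_V4] play no role. *)
Definition cG_V4 : cspace CC := cquot (coset_V4 : cpmx3 -> _).
Definition G_V4 : set cG_V4 := coset_V4 @` PGL3.

Definition four_G_V4 : set (ccopies 4 cG_V4) := [set: 'I_4] `*` G_V4.

Definition j_base : set CC := [set z | z != 0 /\ z != 1728].

End Conics.

Arguments transverse_pairs R : clear implicits.
Arguments cayley_set R : clear implicits.
Arguments j_inv R : clear implicits.
Arguments PGL3 R : clear implicits.
Arguments orbit_of R : clear implicits.
Arguments special_moduli R : clear implicits.
Arguments special_pairs R : clear implicits.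
Arguments V4 R : clear implicits.
Arguments G_V4 R : clear implicits.
Arguments four_G_V4 R : clear implicits.
Arguments j_base R : clear implicits.

(* Main.v *)
Require Import Defs.
From HB Require Import structures.
From mathcomp Require Import all_boot all_order all_algebra.
From mathcomp Require Import perm complex.
From mathcomp Require Import all_classical all_reals all_analysis.
From mathcomp Require Import ring.

Set Implicit Arguments.
Unset Strict Implicit.
Unset Printing Implicit Defensive.
Import Order.TTheory GRing.Theory Num.Theory.
Import numFieldNormedType.Exports.
Local Open Scope classical_set_scope.
Local Open Scope ring_scope.

(* A pair of conics meeting in four points is simultaneously diagonalizable
   with distinct ratios of eigenvalues: no three of the points are collinear, so
   they can be moved to [(+-1 : +-1 : 1)], and the conics through these four
   points are diagonal.  Hence every pair is [(g diag(l) g^T, g g^T)], where [l]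
   is unique up to permutation and scaling and [g], for a fixed [l] with
   non-zero sum, up to [V_4].  The Cayley condition reads [e_1^2 = 4 e_2] in the
   elementary symmetric functions of [l]; if [e_1 = 0] then [j = 0], so outside
   the special set one normalizes [e_1 = 2], [e_2 = 1], and [l] lists the roots of
   [X (X - 1)^2 = s] with [s = e_3].  Then
   [j = 256 (1 - 6 s)^3 / (s^3 (4 - 27 s))], a map of degree 4 in [s] with critical
   values [0] and [1728] only.  Over a small open set of values of [j] the four
   solutions [s] and the three roots [l] are holomorphic, which trivializes the
   family of orbits; in the other direction [g] is recovered, up to signs, from
   square roots of the spectral projections of [C D^-1]. *)

(** * Differentiability of algebraic operations *)

(** Why 0 and 1728: as a self-map of the sphere, s -> j has degree 4, hence 6 critical points with
    multiplicity. Two lie at the triple pole s = 0, two at the triple zero s = 1/6, and the last two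
    are the roots of 27 s^2 - 18 s + 2, both over 1728. The fourth point over 0 is s = infinity:
    there e_1 = e_2 = 0, the entries of l are permuted cyclically by a scaling, and the stabilizer
    exceeds V_4. The poles s = 0 and s = 4/27 are degenerate. The obstacle is holomorphy. Points of
    projective spaces and of G/V_4 are classes, and a holomorphic map needs a local lift to
    representatives that is differentiable on a whole neighbourhood of matrices, not only over the
    Cayley set. So j, the eigenvalues and the columns of g are extended there by rational functions
    and local branches of simple roots. The two conics are moreover rescaled independently; it is
    the condition e_1 = 2 that ties the two scalars together and reduces stabilizers to signs. *)

Section Differentiability.
Variables (K : numFieldType) (V : normedModType K).
Implicit Types (v : V).

Lemma differentiable_mulr (f g : V -> K) v :
  differentiable f v -> differentiable g v ->
  differentiable (fun x => f x * g x) v.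
Proof. by move=> df dg; exact: (differentiableM df dg). Qed.

Lemma differentiable_addr (W : normedModType K) (f g : V -> W) v :
  differentiable f v -> differentiable g v ->
  differentiable (fun x => f x + g x) v.
Proof. by move=> df dg; exact: (differentiableD df dg). Qed.

Lemma differentiable_oppr (W : normedModType K) (f : V -> W) v :
  differentiable f v -> differentiable (fun x => - f x) v.
Proof. by move=> df; exact: (differentiableN df). Qed.

Lemma differentiable_sumr (I : Type) (r : seq I) (P : pred I) (W : normedModType K)
    (f : I -> V -> W) v :
  (forall i, P i -> differentiable (f i) v) ->
  differentiable (fun x => \sum_(i <- r | P i) f i x) v.
Proof.
move=> df; rewrite (_ : (fun x => _) = \sum_(i <- r | P i) f i); last first.
  by apply/funext => x; rewrite fct_sumE.
by elim/big_ind : _ => // g h dg dh; exact: differentiableD.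
Qed.

Lemma differentiable_prodr (I : Type) (r : seq I) (P : pred I)
    (f : I -> V -> K) v :
  (forall i, P i -> differentiable (f i) v) ->
  differentiable (fun x => \prod_(i <- r | P i) f i x) v.
Proof.
move=> df; elim: r => [|a r IH].
  by under eq_fun do rewrite big_nil; exact: differentiable_cst.
case Pa: (P a); under eq_fun do rewrite big_cons Pa; last exact: IH.
by apply: differentiable_mulr => //; exact: df.
Qed.

Lemma differentiable_mx m n (f : V -> 'M[K]_(m, n)) v :
  (forall i j, differentiable (fun x => f x i j) v) -> differentiable f v.
Proof.
move=> df; rewrite (_ : f = fun x => \sum_i \sum_j f x i j *: delta_mx i j).
  do 2![apply: differentiable_sumr => ? _]; exact: differentiableZl.
by apply/funext => x; exact: matrix_sum_delta.
Qed.

Lemma differentiable_mxE m n (f : V -> 'M[K]_(m, n)) v i j :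
  differentiable f v -> differentiable (fun x => f x i j) v.
Proof.
by move=> df; exact: (differentiable_comp df (differentiable_coord _ _ _)).
Qed.

Lemma differentiable_mulmx m n p (f : V -> 'M[K]_(m, n)) (g : V -> 'M[K]_(n, p)) v :
  differentiable f v -> differentiable g v ->
  differentiable (fun x => f x *m g x) v.
Proof.
move=> df dg; apply: differentiable_mx => i j.
under eq_fun do rewrite mxE.
by apply: differentiable_sumr => k _; apply: differentiable_mulr; apply: differentiable_mxE.
Qed.

Lemma differentiable_trmx m n (f : V -> 'M[K]_(m, n)) v :
  differentiable f v -> differentiable (fun x => (f x)^T) v.
Proof.
move=> df; apply: differentiable_mx => i j.
by under eq_fun do rewrite mxE; exact: differentiable_mxE.
Qed.

Lemma differentiable_det n (f : V -> 'M[K]_n) v :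
  differentiable f v -> differentiable (fun x => \det (f x)) v.
Proof.
move=> df; rewrite /determinant; apply: differentiable_sumr => s _.
apply: differentiable_mulr; first exact: differentiable_cst.
by apply: differentiable_prodr => i _; exact: differentiable_mxE.
Qed.

Lemma differentiable_adj n (f : V -> 'M[K]_n) v :
  differentiable f v -> differentiable (fun x => \adj (f x)) v.
Proof.
move=> df; apply: differentiable_mx => i j.
under eq_fun do rewrite mxE /cofactor.
apply: differentiable_mulr; first exact: differentiable_cst.
apply: differentiable_det; apply: differentiable_mx => k l.
by under eq_fun do rewrite !mxE; exact: differentiable_mxE.
Qed.

Lemma differentiable_coef_pencil n (f g : V -> 'M[K]_n) v k :
  differentiable f v -> differentiable g v ->
  differentiable
    (fun x => (\det ('X *: map_mx polyC (f x) + map_mx polyC (g x)))`_k) v.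
Proof.
move=> df dg; under eq_fun do rewrite /determinant coef_sum.
apply: differentiable_sumr => s _.
pose h i x : {poly K} := 'X * (f x i (s i))%:P + (g x i (s i))%:P.
rewrite (_ : (fun x => _) =
  fun x => (-1) ^+ s * (\prod_i h i x)`_k); last first.
  apply/funext => x; rewrite -(rmorph_sign (@polyC K)) coefCM.
  congr (_ * nth 0 (polyseq _) k).
  by apply: eq_bigr => i _; rewrite !mxE.
apply: differentiable_mulr; first exact: differentiable_cst.
(* The index [k] is generalized because a coefficient of a product is a convolution of coefficients
   of the factors; each factor is affine in ['X]. *)
elim: (index_enum _) k => [|a r IH] k.
  by under eq_fun do rewrite big_nil; exact: differentiable_cst.
under eq_fun do rewrite big_cons coefM.
apply: differentiable_sumr => i _; apply: differentiable_mulr => //.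
case: (nat_of_ord i) => [|[|l]];
  under eq_fun do rewrite /h coefD coefXM !coefC /= ?add0r ?addr0.
- exact: differentiable_mxE.
- exact: differentiable_mxE.
- exact: differentiable_cst.
Qed.

Lemma differentiable_horner (p : {poly K}) (f : V -> K) v :
  differentiable f v -> differentiable (fun x => p.[f x]) v.
Proof.
move=> df; elim/poly_ind: p => [|p c IH].
  by under eq_fun do rewrite horner0; exact: differentiable_cst.
under eq_fun do rewrite hornerMXaddC.
apply: differentiable_addr; last exact: differentiable_cst.
exact: differentiable_mulr.
Qed.

End Differentiability.

Lemma differentiable_scale (K : numFieldType) (V : normedModType K) m n
    (k : V -> K) (f : V -> 'M[K]_(m, n)) v :
  differentiable k v -> differentiable f v ->
  differentiable (fun x => k x *: f x) v.
Proof.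
move=> dk df; apply: differentiable_mx => i j; under eq_fun do rewrite mxE.
by apply: differentiable_mulr => //; exact: differentiable_mxE.
Qed.

Lemma differentiable_scalar_mx (K : numFieldType) (V : normedModType K) n
    (k : V -> K) v :
  differentiable k v -> differentiable (fun x => (k x)%:M : 'M[K]_n) v.
Proof.
move=> dk; apply: differentiable_mx => i j.
rewrite (_ : (fun x => _) = fun x => k x * (i == j)%:R); last first.
  by apply/funext => x; rewrite mxE mulr_natr.
by apply: differentiable_mulr => //; exact: differentiable_cst.
Qed.

Lemma differentiable_fst (K : numFieldType) (V W : normedModType K) (x : V * W) :
  differentiable (fun y : V * W => y.1) x.
Proof. by apply: (@linear_differentiable _ _ _ fst) => y; exact: cvg_fst. Qed.

Lemma differentiable_snd (K : numFieldType) (V W : normedModType K) (x : V * W) :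
  differentiable (fun y : V * W => y.2) x.
Proof. by apply: (@linear_differentiable _ _ _ snd) => y; exact: cvg_snd. Qed.

Lemma cvg_dist_squeeze (K : numFieldType) (V : normedModType K) (T : Type)
    (F : set_system T) {FF : Filter F} (f : T -> V) (g : T -> K) (a : V) :
  (\forall t \near F, `|f t - a| <= g t) -> g t @[t --> F] --> 0 ->
  f t @[t --> F] --> a.
Proof.
move=> fg /cvgrPdist_lt g0; apply/cvgrPdist_lt => e e0.
near=> t; rewrite distrC; apply: (@le_lt_trans _ _ (g t)); first by near: t.
have gt0 : 0 <= g t by apply: (le_trans (normr_ge0 (f t - a))); near: t.
by rewrite -[g t]ger0_norm // -normrN -sub0r; near: t; exact: g0.
Unshelve. all: by end_near.
Qed.

(** * Holomorphic branches of algebraic functions *)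

Section Roots.
Variable K : numClosedFieldType.
Implicit Types p q : {poly K}.

(* From [p'/p = \sum_r 1/(x - r)], some root satisfies
   [|p'(x)/p(x)| <= n / |x - r|]. *)
Lemma root_near p x : p^`().[x] != 0 ->
  exists2 r, root p r & `|r - x| * `|p^`().[x]| <= (size p)%:R * `|p.[x]|.
Proof.
move=> dp0; have [px0|px0] := eqVneq p.[x] 0.
  by exists x; [apply/rootP|rewrite subrr normr0 mul0r px0 normr0 mulr0].
have p0 : p != 0 by apply: contraNneq px0 => ->; rewrite horner0.
have [rs prs] := closed_field_poly_normal p.
have lc0 : lead_coef p != 0 by rewrite lead_coef_eq0.
have szp : size p = (size rs).+1 by rewrite prs size_scale // size_prod_XsubC.
apply: contrapT => H.
have {}H r : r \in rs -> (size p)%:R * `|p.[x]| <= `|x - r| * `|p^`().[x]|.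
  move=> rrs; rewrite real_leNgt ?ger0_real ?mulr_ge0 //; apply/negP => h.
  apply: H; exists r; last by rewrite distrC ltW.
  by rewrite prs rootZ // root_prod_XsubC.
pose q s := \prod_(z <- s) ('X - z%:P) : {poly K}.
(* The bound on the logarithmic derivative, cleared of denominators so that it can be proved by
   induction on sublists. For the full list, the factor [size p], one more than the number of roots,
   makes it absurd. *)
have key s : {subset s <= rs} -> `|(q s)^`().[x]| * ((size p)%:R * `|p.[x]|)
    <= (size s)%:R * `|(q s).[x]| * `|p^`().[x]|.
  elim: s => [|a s IH] Hs.
    by rewrite /q big_nil derivC horner0 normr0 !mul0r.
  have {}IH := IH (fun r rs1 => Hs r (mem_behead (s := a :: s) rs1)).
  have Ha := H _ (Hs _ (mem_head a s)).
  have -> : q (a :: s) = ('X - a%:P) * q s by rewrite /q big_cons.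
  rewrite derivM derivXsubC mul1r hornerD !hornerM hornerXsubC /= normrM.
  apply: (@le_trans _ _ ((`|(q s).[x]| + `|x - a| * `|(q s)^`().[x]|)
                         * ((size p)%:R * `|p.[x]|))).
    by rewrite ler_wpM2r ?mulr_ge0 // (le_trans (ler_normD _ _)) // normrM.
  rewrite mulrDl -natr1 mulrDl mulrDl mul1r addrC; apply: lerD.
    rewrite -!mulrA [leRHS]mulrCA ler_wpM2l //.
    by apply: le_trans IH _; rewrite mulrA.
  by rewrite [`|x - a| * _]mulrC -[leRHS]mulrA ler_wpM2l.
have := key rs (fun _ => id).
have -> : q rs = (lead_coef p)^-1 *: p.
  by rewrite [X in _ *: X]prs scalerA mulVf // scale1r.
rewrite derivZ !hornerZ !normrM.
set A := `|_^-1|; set B := `|p^`().[x]|; set C := `|p.[x]| => le1.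
have ABC : 0 < A * B * C by rewrite !mulr_gt0 ?normr_gt0 ?invr_eq0.
have : A * B * C * (size p)%:R <= A * B * C * (size rs)%:R.
  by move: le1; congr (_ <= _); ring.
by rewrite ler_pM2l // ler_nat szp ltnn.
Qed.

End Roots.

(** * Simple roots as functions of a parameter *)

Section RootBranch.
Variable K : numFieldType.
Implicit Types p q : {poly K}.

(** Since [Q] is a polynomial in two variables, the difference quotient is continuous across the
    diagonal. For [p * 'X + c] the recursion is [x p(x) - y p(y) = (x - y) p(x) + y (p(x) -
    p(y))]. *)
Lemma divided_difference p : exists Q : K * K -> K,
  [/\ continuous Q, forall x, Q (x, x) = p^`().[x]
    & forall x y, p.[x] - p.[y] = (x - y) * Q (x, y)].
Proof.
elim/poly_ind: p => [|p c [Q [cQ Qd QE]]].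
  exists (fun _ => 0); split=> [|x|x y]; first exact: cst_continuous.
    by rewrite derivC horner0.
  by rewrite !horner0 subrr mulr0.
exists (fun z => p.[z.1] + z.2 * Q z); split=> [z|x|x y].
- apply: cvgD; last by apply: cvgM; [exact: cvg_snd|exact: cQ].
  apply: (@continuous_comp _ _ _ fst (horner p)); first exact: cvg_fst.
  exact/differentiable_continuous/differentiable_horner.
- by rewrite Qd derivD derivM derivX derivC addr0 mulr1 hornerD hornerM hornerX
    addrC mulrC /=.
- rewrite !hornerD !hornerM !hornerX !hornerC mulrDr mulrCA -QE /=; ring.
Qed.

(* The bound of the first hypothesis makes the chosen root continuous at [t0];
   the divided differences then make it Lipschitz and differentiable nearby. *)
Lemma root_branch_of p q x0 t0 :
  (forall p x, p^`().[x] != 0 ->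
    exists2 r, root p r & `|r - x| * `|p^`().[x]| <= (size p)%:R * `|p.[x]|) ->
  p.[x0] = t0 * q.[x0] ->
  p^`().[x0] - t0 * q^`().[x0] != 0 ->
  exists2 r : K -> K, r t0 = x0 &
    \forall t \near t0, differentiable r t /\ p.[r t] = t * q.[r t].
Proof.
move=> Hroot e0 d0.
pose P t := p - t *: q; pose dP t := p^`().[x0] - t * q^`().[x0].
have dPE t : (P t)^`().[x0] = dP t.
  by rewrite /P derivB derivZ !hornerE.
pose N : K := (maxn (size p) (size q))%:R.
pose good t z := root (P t) z /\ `|z - x0| * `|dP t| <= N * `|(P t).[x0]|.
have ex t : dP t != 0 -> exists z, good t z.
  move=> dPt; have [|z rz hz] := Hroot (P t) x0; first by rewrite dPE.
  exists z; split=> //; rewrite -dPE; apply: le_trans hz _.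
  rewrite ler_wpM2r // ler_nat (leq_trans (size_polyD _ _)) // size_polyN.
  by rewrite geq_max leq_maxl /= (leq_trans (size_scale_leq _ _)) // leq_maxr.
pose r t := xget x0 (good t).
have rP t : dP t != 0 -> good t (r t).
  by move=> /ex[z gz]; exact: (xgetPex x0 (ex_intro _ z gz)).
have rt0 : r t0 = x0.
  have [_] := rP _ d0; rewrite /P !hornerE e0 subrr normr0 mulr0.
  rewrite -normrM normr_le0 mulf_eq0 (negPf d0) orbF subr_eq0.
  by move=> /eqP.
have dPc : continuous dP.
  move=> t; apply: differentiable_continuous; apply: differentiable_addr.
    exact: differentiable_cst.
  apply: differentiable_oppr; apply: differentiable_mulr => //.
have dP0 : \forall t \near t0, dP t != 0.
  exact: (cvgr_neq0 _ (dPc t0) d0).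
pose e t := p.[x0] - t * q.[x0].
have eE t : (P t).[x0] = e t by rewrite /P !hornerE.
have et0 : e t0 = 0 by rewrite /e e0 subrr.
pose g t := N * `|e t| / `|dP t|.
have g0 : g t0 = 0 by rewrite /g et0 normr0 mulr0 mul0r.
have gc : g t @[t --> t0] --> g t0.
  have nz : `|dP t0| != 0 by rewrite normr_eq0.
  have c1 : e t @[t --> t0] --> e t0.
    apply: differentiable_continuous; apply: differentiable_addr.
      exact: differentiable_cst.
    by apply: differentiable_oppr; apply: differentiable_mulr.
  exact: (cvgM (cvgM (cvg_cst N) (cvg_norm c1)) (cvgV nz (cvg_norm (dPc t0)))).
have rc0 : r t @[t --> t0] --> x0.
  rewrite g0 in gc; apply: (@cvg_dist_squeeze K K _ (nbhs t0) _ r g) => //.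
  near=> t; have dPt : dP t != 0 by near: t.
  have [_ h] := rP _ dPt.
  by rewrite /g ler_pdivlMr ?normr_gt0 // -eE.
have [Qp [cQp Qpd QpE]] := divided_difference p.
have [Qq [cQq Qqd QqE]] := divided_difference q.
pose Q (z : K * K) t := Qp z - t * Qq z.
have Qc (T : Type) (F : set_system T) (FF : Filter F) (u v w : T -> K) (a b c : K) :
    u x @[x --> F] --> a -> v x @[x --> F] --> b -> w x @[x --> F] --> c ->
    Q (u x, v x) (w x) @[x --> F] --> Q (a, b) c.
  move=> ua vb wc.
  have uv : (u x, v x) @[x --> F] --> (a, b) by exact: (cvg_pair ua vb).
  have cp : Qp (u x, v x) @[x --> F] --> Qp (a, b) by exact: (cvg_comp _ _ uv (cQp (a, b))).
  have cq : Qq (u x, v x) @[x --> F] --> Qq (a, b) by exact: (cvg_comp _ _ uv (cQq (a, b))).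
  have h := cvgB cp (cvgM wc cq).
  exact: h.
(* Subtracting the equations of [r t] and [r t1] expresses the increment of [r] as [(t - t1) *
   q.[r t1]] over [Q]; both the Lipschitz bound and the derivative [q.[r t1] / Q (r t1, r t1) t1]
   are read off from this. *)
have QE t t1 : dP t != 0 -> dP t1 != 0 ->
    (r t - r t1) * Q (r t, r t1) t = (t - t1) * q.[r t1].
  move=> /rP[+ _] /rP[+ _]; rewrite /P !rootE !hornerE => /eqP rt /eqP rt1.
  rewrite /Q mulrBr -QpE mulrCA -QqE.
  transitivity ((p.[r t] - t * q.[r t]) - (p.[r t1] - t1 * q.[r t1])
     + (t - t1) * q.[r t1]); first ring.
  by rewrite rt rt1 subrr add0r.
have Q00 : Q (x0, x0) t0 != 0 by rewrite /Q Qpd Qqd.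
pose de := `|Q (x0, x0) t0| / 2.
have de0 : 0 < de by rewrite divr_gt0 ?normr_gt0.
have QA : \forall z \near (t0, t0), de < `|Q (r z.1, r z.2) z.1|.
  have c : Q (r z.1, r z.2) z.1 @[z --> (t0, t0)] --> Q (x0, x0) t0.
    apply: Qc; last exact: cvg_fst.
      by apply: (cvg_comp _ _ _ rc0); exact: cvg_fst.
    by apply: (cvg_comp _ _ _ rc0); exact: cvg_snd.
  apply: (cvgr_norm_gt _ c); rewrite /de ltr_pdivrMr // ltr_pMr ?normr_gt0 //.
  by rewrite ltr1n.
(* One neighbourhood serves both arguments, so that the base point may move: differentiability is
   wanted near [t0], not only at it. *)
have [A [nA AQ]] : exists A : set K, nbhs t0 A /\
    forall t t1, A t -> A t1 -> dP t != 0 /\ de < `|Q (r t, r t1) t|.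
  case: QA => -[A B] /= [nA nB] AB.
  exists [set t | [/\ A t, B t & dP t != 0]]; split.
    by near do split.
  move=> t t1 [At _ dt] [_ Bt1 _]; split=> //.
  exact: (AB (t, t1)).
exists r => //; near=> t1.
have nA1 : nbhs t1 A by near: t1; exact/nbhs_interior.
have At1 : A t1 by exact: nbhs_singleton nA1.
have [dP1 deQ1] := AQ _ _ At1 At1.
have [/rootP rt1 _] := rP _ dP1; split; last first.
  by apply/eqP; rewrite -subr_eq0 -rt1 /P !hornerE.
have Qn0 (x : K) : de < `|x| -> x != 0.
  by move=> h; rewrite -normr_gt0; exact: lt_trans h.
have rc1 : r t @[t --> t1] --> r t1.
  pose G t := `|t - t1| * `|q.[r t1]| / de.
  have G0 : G t1 = 0 by rewrite /G subrr normr0 !mul0r.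
  have Gc : G t @[t --> t1] --> G t1.
    have c1 : (t - t1) @[t --> t1] --> t1 - t1.
      exact: (cvgB cvg_id (cvg_cst t1)).
    exact: (cvgM (cvgM (cvg_norm c1) (cvg_cst _)) (cvg_cst _)).
  rewrite G0 in Gc; apply: (@cvg_dist_squeeze K K _ (nbhs t1) _ r G) => //.
  near=> t; have At : A t by near: t.
  have [dPt deQ] := AQ _ _ At At1.
  rewrite /G ler_pdivlMr // -normrM -QE // normrM.
  by rewrite ler_wpM2l // ltW.
apply/derivable1_diffP; rewrite /derivable.
apply: (@cvgP _ _ (q.[r t1] / Q (r t1, r t1) t1)).
have sh : (h *: (1:K) + t1) @[h --> (0:K)^'] --> t1.
  have E : (0 : K) *: (1 : K) + t1 = t1 by rewrite scale0r add0r.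
  have c : {for (0 : K), continuous (fun h : K => h *: (1:K) + t1)}.
    apply: differentiable_continuous; apply: differentiable_addr.
      exact: differentiableZl.
    exact: differentiable_cst.
  by move=> B B1; apply: nbhs_dnbhs; apply: c; rewrite E.
apply: (@cvg_trans _
  ((q.[r t1] / Q (r (h *: (1:K) + t1), r t1) (h *: (1:K) + t1)) @[h --> (0:K)^'])).
  apply: near_eq_cvg; near=> h.
  have h0 : h != 0 by near: h; exact: nbhs_dnbhs_neq.
  have Ah : A (h *: 1 + t1) by near: h; exact: sh.
  have [dPh deh] := AQ _ _ Ah At1.
  have := QE _ _ dPh dP1; rewrite addrK => E.
  apply: (mulIf (Qn0 _ deh)); rewrite mulfVK ?Qn0 //=.
  by rewrite -[_ *: _]/(_ * _) -mulrA E -[h *: _]/(h * 1) mulr1 mulKf.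
exact: (cvgM (cvg_cst (q.[r t1]))
  (cvgV (Qn0 _ deQ1) (Qc _ _ _ _ _ _ _ _ _ (cvg_comp _ _ sh rc1) (cvg_cst (r t1)) sh))).
Unshelve. all: by end_near.
Qed.

End RootBranch.

Lemma root_branch (K : numClosedFieldType) (p q : {poly K}) x0 t0 :
  p.[x0] = t0 * q.[x0] -> p^`().[x0] - t0 * q^`().[x0] != 0 ->
  exists2 r : K -> K, r t0 = x0 &
    \forall t \near t0, differentiable r t /\ p.[r t] = t * q.[r t].
Proof. exact: (root_branch_of (@root_near K)). Qed.

(** [sqrtC z0] is a simple root of [X^2 = z0] because [z0] is not 0; [sqrtC] supplies only the
    starting value of the branch. *)
Lemma sqrt_local (K : numClosedFieldType) (z0 : K) : z0 != 0 ->
  exists q : K -> K, \forall z \near z0, differentiable q z /\ q z ^+ 2 = z.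
Proof.
move=> z0n; have [||q q0 qP] := @root_branch K ('X * 'X) 1 (sqrtC z0) z0.
- by rewrite !hornerE -expr2 sqrtCK.
- rewrite derivM derivX -polyC1 derivC mul1r mulr1 hornerD hornerX horner0.
  by rewrite mulr0 subr0 -mulr2n mulrn_eq0 sqrtC_eq0.
exists q; apply: filterS qP => z [dq qE]; split => //.
by move: qE; rewrite expr2 !hornerE.
Qed.

(** * Holomorphic maps and projective spaces *)

Section Holomorphic.
Variable K : numFieldType.

Lemma holomorphic_comp (S1 S2 S3 : cspace K) (X : set S1) (Y : set S2)
    (Z : set S3) f g :
  holomorphic X Y f -> holomorphic Y Z g -> holomorphic X Z (g \o f).
Proof.
move=> [fXY hf] [gYZ hg]; split; first by move=> x Xx; exact/gYZ/fXY.
move=> i v iv Xv; have [i' [F HF]] := hf i v iv Xv.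
have [dFv /(_ Xv)[i'F EF]] := nbhs_singleton HF.
have [i'' [G HG]] : exists i'' (G : cmodel S2 -> cmodel S3),
    \forall w \near F v, differentiable G w /\
      (Y (cpar i' w) -> cdom i'' (G w) /\ cpar i'' (G w) = g (cpar i' w)).
  by apply: hg => //; rewrite EF; exact: fXY.
exists i'', (G \o F).
have {}HG := differentiable_continuous dFv HG.
apply: filterS2 HF HG => w [dF HFw] /= [dG HGw].
split; first exact: differentiable_comp.
move=> Xw; have [i'Fw EFw] := HFw Xw.
by rewrite -EFw; apply: HGw; rewrite EFw; exact: fXY.
Qed.

Lemma holomorphic_sub (S1 S2 : cspace K) (X X' : set S1) (Y Y' : set S2) f :
  X' `<=` X -> set_fun X' Y' f -> holomorphic X Y f -> holomorphic X' Y' f.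
Proof.
move=> X'X fX' [_ hf]; split=> // i v iv X'v.
have [i' [F HF]] := hf i v iv (X'X _ X'v).
by exists i', F; apply: filterS HF => w [dF HFw]; split=> // /X'X.
Qed.

End Holomorphic.

Section ProjectiveTheory.
Variables (K : numFieldType) (m n : nat).
Implicit Types (M N : 'M[K]_(m.+1, n.+1)) (p : pspace K m n).

Lemma prep_neq0 p : prep p != 0.
Proof. exact: (valP (repr p)). Qed.

Lemma prepK p : pclass (prep p) = p.
Proof. by rewrite /pclass /prep valKd reprK. Qed.

Lemma pclassP M N : M != 0 -> N != 0 ->
  pclass M = pclass N <-> exists2 c : K, c != 0 & N = c *: M.
Proof.
move=> M0 N0; rewrite /pclass; split.
  by move=> /eqquotP /asboolP; rewrite !insubdK.
by move=> H; apply/eqquotP/asboolP; rewrite !insubdK.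
Qed.

Lemma pclassZ (c : K) M : c != 0 -> pclass (c *: M) = pclass M.
Proof.
move=> c0; have [->|M0] := eqVneq M 0; first by rewrite scaler0.
by apply/esym/pclassP; rewrite ?scaler_eq0 ?negb_or ?c0 //; exists c.
Qed.

Lemma prep_pclass M : M != 0 -> exists2 c : K, c != 0 & prep (pclass M) = c *: M.
Proof. by move=> M0; apply/(pclassP M0 (prep_neq0 _)); rewrite prepK. Qed.

End ProjectiveTheory.

(** * Simultaneously diagonal pairs of conics *)

Section DiagonalForm.
Variable K : numClosedFieldType.
Implicit Types (g h : 'M[K]_3) (l a b : 'rV[K]_3).

(** The columns of [g] are three linear forms, and the conic is the sum of [l 0 k] times their
    squares. For invertible [g] they are the sides of a triangle that is self-polar for both
    [diag_form g l] and [g *m g^T]. *)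
Definition diag_form g l : 'M[K]_3 := g *m diag_mx l *m g^T.

Lemma diag_formE g l i j : diag_form g l i j = \sum_k g i k * l 0 k * g j k.
Proof.
rewrite /diag_form mxE; apply: eq_bigr => k _.
by rewrite mul_mx_diag !mxE.
Qed.

Lemma diag_formZ c g l : diag_form g (c *: l) = c *: diag_form g l.
Proof. by rewrite /diag_form linearZ /= -scalemxAr -scalemxAl. Qed.

Lemma diag_form1 g : diag_form g (const_mx 1) = g *m g^T.
Proof. by rewrite /diag_form diag_const_mx mulmx1. Qed.

Lemma diag_formM h g l : diag_form (h *m g) l = h *m diag_form g l *m h^T.
Proof. by rewrite /diag_form trmx_mul !mulmxA. Qed.

Lemma diag_form_scale_col g a l :
  diag_form (g *m diag_mx a) l = diag_form g (\row_k (a 0 k ^+ 2 * l 0 k)).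
Proof.
apply/matrixP => i j; rewrite !diag_formE; apply: eq_bigr => k _.
by rewrite !mul_mx_diag !mxE; ring.
Qed.

Lemma diag_formZl c g l : diag_form (c *: g) l = c ^+ 2 *: diag_form g l.
Proof.
by rewrite /diag_form linearZ /= -!scalemxAl -scalemxAr scalerA -expr2.
Qed.

Lemma det_diag_form g l : \det (diag_form g l) = \det g ^+ 2 * \prod_k l 0 k.
Proof. by rewrite /diag_form !det_mulmx det_tr det_diag mulrAC -expr2. Qed.

Lemma diag_form_sym g l : (diag_form g l)^T = diag_form g l.
Proof. by rewrite /diag_form !trmx_mul trmxK tr_diag_mx mulmxA. Qed.

Definition pencil (C D : 'M[K]_3) : {poly K} :=
  \det ('X *: map_mx polyC C + map_mx polyC D).

Lemma horner_pencil C D t : (pencil C D).[t] = \det (t *: C + D).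
Proof.
rewrite /pencil -horner_evalE -det_map_mx; congr (\det _).
by apply/matrixP => i j; rewrite !mxE /= /horner_eval !hornerE.
Qed.

Lemma pencil_diag g a b : pencil (diag_form g a) (diag_form g b) =
  (\det g ^+ 2)%:P * \prod_k ((a 0 k)%:P * 'X + (b 0 k)%:P).
Proof.
have -> : pencil (diag_form g a) (diag_form g b) =
  \det (map_mx polyC g *m diag_mx (\row_k ((a 0 k)%:P * 'X + (b 0 k)%:P))
    *m (map_mx polyC g)^T).
  have E (A B : 'M[K]_3) i j : ('X *: map_mx polyC A + map_mx polyC B) i j
      = 'X * (A i j)%:P + (B i j)%:P by rewrite !mxE.
  congr (\det _); apply/matrixP => i j; rewrite E !diag_formE [RHS]mxE.
  rewrite !rmorph_sum big_distrr -big_split /=; apply: eq_bigr => k _.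
  by rewrite mul_mx_diag !mxE !rmorphM /=; ring.
rewrite !det_mulmx det_tr det_map_mx det_diag mulrAC -rmorphM -expr2.
by congr (_ * _); apply: eq_bigr => k _; rewrite mxE.
Qed.

Definition esym1 l : K := l 0 0 + l 0 1 + l 0 2.
Definition esym2 l : K := l 0 0 * l 0 1 + l 0 0 * l 0 2 + l 0 1 * l 0 2.
Definition esym3 l : K := l 0 0 * l 0 1 * l 0 2.

Lemma big_ord3 (R : Type) (idx : R) (op : Monoid.law idx) (F : 'I_3 -> R) :
  \big[op/idx]_i F i = op (op (F 0) (F 1)) (F 2).
Proof.
rewrite !big_ord_recl big_ord0 Monoid.mulm1 Monoid.mulmA.
by congr (op (op (F _) (F _)) (F _)); apply: val_inj.
Qed.

Lemma forall_ord3 (P : 'I_3 -> Prop) : P 0 -> P 1 -> P 2 -> forall i, P i.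
Proof.
move=> P0 P1 P2 [[|[|[|//]]] i3].
- by rewrite (_ : Ordinal _ = 0) //; exact: val_inj.
- by rewrite (_ : Ordinal _ = 1) //; exact: val_inj.
- by rewrite (_ : Ordinal _ = 2) //; exact: val_inj.
Qed.

(** The scalars [c] and [d] are the freedom in choosing representatives of the two classes. Weighted
    homogeneity in them is what lets [j], the Cayley condition and [e_3 / e_1^3] descend to pairs of
    conics. *)
Lemma pencil_coef g l c d (s := pencil (c *: diag_form g l) (d *: (g *m g^T))) :
  [/\ s`_0 = \det g ^+ 2 * d ^+ 3,
      s`_1 = \det g ^+ 2 * (d ^+ 2 * c * esym1 l),
      s`_2 = \det g ^+ 2 * (d * c ^+ 2 * esym2 l)
    & s`_3 = \det g ^+ 2 * (c ^+ 3 * esym3 l)].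
Proof.
have -> : s = (\det g ^+ 2)%:P *
   ((d ^+ 3)%:P + (d ^+ 2 * c * esym1 l)%:P * 'X
   + (d * c ^+ 2 * esym2 l)%:P * 'X^2 + (c ^+ 3 * esym3 l)%:P * 'X^3).
  rewrite /s -diag_form1 -!diag_formZ pencil_diag big_ord3 !mxE mulr1.
  by rewrite /esym1 /esym2 /esym3 !(rmorphD, rmorphM, rmorphXn) /=; ring.
by split; rewrite coefCM !coefD !coefCM coefC coefX !coefXn /=; ring.
Qed.

End DiagonalForm.

(** * Uniqueness of the diagonal form and recovery of [g] *)

Section DiagonalFormUniqueness.
Variable K : numClosedFieldType.
Implicit Types (g h : 'M[K]_3) (l : 'rV[K]_3) (c d : K).

(** Equal pairs have equal pencils: the constant coefficient gives [det g'^2 = d^3 det g^2], and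
    cancelling it in degrees 1 and 3 leaves the two relations. *)
Lemma diag_form_esym g g' l l' c d : g \in unitmx -> d != 0 ->
  diag_form g' l' = c *: diag_form g l -> g' *m g'^T = d *: (g *m g^T) ->
  d * esym1 l' = c * esym1 l /\ d ^+ 3 * esym3 l' = c ^+ 3 * esym3 l.
Proof.
move=> gu d0 El Eg; have [p0 p1 _ p3] := pencil_coef g l c d.
have [q0 q1 _ q3] := pencil_coef g' l' 1 1.
rewrite !scale1r El Eg in q0 q1 q3.
rewrite p0 in q0; rewrite p1 in q1; rewrite p3 in q3.
have dg : \det g ^+ 2 != 0 by rewrite expf_neq0 // -unitfE -unitmxE.
move: q0 q1 q3; rewrite !(expr1n, mul1r, mulr1) => <- q1 q3.
split.
  apply: (mulfI dg); apply: (mulfI (expf_neq0 2 d0)).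
  by transitivity (\det g ^+ 2 * d ^+ 3 * esym1 l'); [ring|rewrite -q1; ring].
by apply: (mulfI dg); rewrite mulrA -q3.
Qed.

(** The matrix [A = g^-1 g'] satisfies [A A^T = d] and multiplies the form [diag l] by the same [d],
    so it commutes with [diag l]. Distinct eigenvalues make it diagonal, and [A A^T = d] then fixes
    the squares of its entries. *)
Lemma diag_form_stab g g' l d : g \in unitmx -> d != 0 ->
  injective (l 0) ->
  diag_form g' l = d *: diag_form g l -> g' *m g'^T = d *: (g *m g^T) ->
  exists2 a : 'rV[K]_3, forall k, a 0 k ^+ 2 = d & g' = g *m diag_mx a.
Proof.
move=> gu d0 linj El Eg; pose A := invmx g *m g'.
have gE : g' = g *m A by rewrite mulKVmx.
have conjA N : A *m N *m A^T = invmx g *m (g' *m N *m g'^T) *m (invmx g)^T.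
  by rewrite /A trmx_mul !mulmxA.
have conjK N : invmx g *m (g *m N *m g^T) *m (invmx g)^T = N.
  by rewrite -!mulmxA mulKmx // -trmx_mul mulVmx // trmx1 mulmx1.
have AA : A *m A^T = d%:M.
  have := conjA 1%:M; rewrite !mulmx1 Eg -scalemxAr -scalemxAl => ->.
  by have := conjK 1%:M; rewrite mulmx1 => ->; rewrite scalemx1.
have AlA : A *m diag_mx l = diag_mx l *m A.
  have h : A *m diag_mx l *m A^T = d *: diag_mx l.
    by rewrite conjA [X in _ *m X *m _]El -scalemxAr -scalemxAl conjK.
  have AtA : A^T *m A = d%:M.
    have : A *m (d^-1 *: A^T) = 1%:M by rewrite -scalemxAr AA scale_scalar_mx mulVf.
    move=> /mulmx1C; rewrite -scalemxAl => /(congr1 (fun M => d *: M)).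
    by rewrite scalerA divff // scale1r scalemx1.
  have := congr1 (fun M => M *m A) h; rewrite -mulmxA AtA mul_mx_scalar -scalemxAl.
  by move=> /(scalerI d0).
clearbody A.
have Adiag i j : i != j -> A i j = 0.
  move=> ij; have /matrixP/(_ i j) := AlA.
  rewrite mul_mx_diag mul_diag_mx !mxE => /eqP; rewrite mulrC -subr_eq0 -mulrBl mulf_eq0.
  rewrite subr_eq0 => /orP[/eqP/linj ji|/eqP //].
  by rewrite ji eqxx in ij.
exists (\row_k A k k); last first.
  rewrite gE; congr (_ *m _); apply/matrixP => i j; rewrite !mxE.
  by case: eqVneq => [->|/Adiag ->]; rewrite ?mulr1n ?mulr0n.
move=> k; have /matrixP/(_ k k) := AA; rewrite !mxE eqxx mulr1n (bigD1 k) //=.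
rewrite big1 ?addr0 => [|i ik]; first by rewrite !mxE expr2.
by rewrite Adiag ?mul0r // eq_sym.
Qed.

(* For [C = c g diag(l) g^T] and [D = d g g^T] with [esym1 l = 2], the matrix
   [C D^-1] is [(c/d) g diag(l) g^-1] and [c/d] is half its trace. *)
Definition norm_ratio (C D : 'M[K]_3) : 'M[K]_3 :=
  (2 * (pencil C D)`_0 / (pencil C D)`_1) *: (C *m ((\det D)^-1 *: \adj D)).

(* Spectral projection of [norm_ratio C D] to the [k]-th eigenline, times [D]:
   this is [d] times the square of the [k]-th column of [g]. *)
Definition col_square (C D : 'M[K]_3) l k : 'M[K]_3 :=
  ((l 0 k - l 0 (k + 1)) * (l 0 k - l 0 (k + 2)))^-1 *:
  ((norm_ratio C D - (l 0 (k + 1))%:M) *m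
   (norm_ratio C D - (l 0 (k + 2))%:M) *m D).

Lemma ord3_add (k : 'I_3) : (k + 1 != k) && (k + 2 != k) && (k + 1 != k + 2).
Proof. by move: k; exact: forall_ord3. Qed.

Lemma ord3_neq (k i : 'I_3) : i != k -> i = k + 1 \/ i = k + 2.
Proof.
by move: k i; do 2![apply: forall_ord3]; rewrite ?eqxx // => _;
  try (by left; exact: val_inj); right; exact: val_inj.
Qed.

Lemma col_squareE g l c d k : g \in unitmx -> c != 0 -> d != 0 ->
  injective (l 0) -> esym1 l = 2 ->
  forall i j, col_square (c *: diag_form g l) (d *: (g *m g^T)) l k i j
    = d * (g i k * g j k).
Proof.
move=> gu c0 d0 linj l2.
have dg : \det g != 0 by rewrite -unitfE -unitmxE.
have [p0 p1 _ _] := pencil_coef g l c d.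
set C := c *: _ in p0 p1 *; set D := d *: _ in p0 p1 *.
have Du : D \in unitmx.
  by rewrite unitmxE unitfE detZ det_mulmx det_tr !mulf_neq0 ?expf_neq0.
have Rg : norm_ratio C D *m g = g *m diag_mx l.
  rewrite /norm_ratio p0 p1 l2.
  have -> : (\det D)^-1 *: \adj D = invmx D by rewrite /invmx Du.
  have -> : 2 * (\det g ^+ 2 * d ^+ 3) / (\det g ^+ 2 * (d ^+ 2 * c * 2)) = d / c.
    by field; rewrite ?c0 ?d0 ?dg.
  have -> : invmx D = d^-1 *: (invmx g^T *m invmx g).
    have DE : D *m (d^-1 *: (invmx g^T *m invmx g)) = 1%:M.
      rewrite /D -scalemxAl -scalemxAr scalerA divff // scale1r.
      by rewrite mulmxA -(mulmxA g) mulmxV ?unitmx_tr // mulmx1 mulmxV.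
    by rewrite -[LHS]mulmx1 -DE mulKmx.
  rewrite /C -scalemxAl -scalemxAr !scalerA -scalemxAl.
  have -> : d / c * c / d = 1 by field; rewrite c0 d0.
  rewrite scale1r /diag_form !mulmxA mulmxKV // mulmxK ?unitmx_tr //.
have RBg (b : K) : (norm_ratio C D - b%:M) *m g = g *m (diag_mx l - b%:M).
  by rewrite mulmxBl Rg mulmxBr mul_scalar_mx mul_mx_scalar.
have [/andP[k1 k2] k3] := andP (ord3_add k).
have lk1 : l 0 k - l 0 (k + 1) != 0.
  by rewrite subr_eq0; apply: contraNneq k1 => /linj <-.
have lk2 : l 0 k - l 0 (k + 2) != 0.
  by rewrite subr_eq0; apply: contraNneq k2 => /linj <-.
have -> : col_square C D l k = d *: diag_form g (delta_mx 0 k).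
  have RRD (x y : K) : (norm_ratio C D - x%:M) *m (norm_ratio C D - y%:M) *m D =
      d *: (g *m ((diag_mx l - x%:M) *m (diag_mx l - y%:M)) *m g^T).
    rewrite {3}/D -scalemxAr; congr (_ *: _).
    by rewrite [LHS]mulmxA -(mulmxA _ _ g) RBg (mulmxA _ g) RBg !mulmxA.
  rewrite /col_square RRD scalerA mulrC -scalerA; congr (_ *: _).
  rewrite /diag_form scalemxAl scalemxAr; congr (_ *m _ *m _).
  apply/matrixP => i j.
  have dE (b : K) : diag_mx l - b%:M = diag_mx (\row_k (l 0 k - b)).
    by apply/matrixP => u v; rewrite !mxE mulrnBl.
  rewrite !dE mul_diag_mx !mxE; case: (eqVneq i j) => _; last first.
    by rewrite !mulr0n !mulr0.
  rewrite !mulr1n eqxx /=; case: (eqVneq i k) => [->|ik].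
    by rewrite mulVf // mulf_neq0.
  by case: (ord3_neq ik) => ->; rewrite subrr ?(mulr0, mul0r).
move=> i j; rewrite mxE diag_formE (bigD1 k) //= mxE !eqxx mulr1 big1 ?addr0 //.
by move=> u uk; rewrite mxE (negPf uk) andbF mulr0 mul0r.
Qed.

End DiagonalFormUniqueness.

(** * Conics meeting in four points *)

Section Transversality.
Variable K : numClosedFieldType.
Implicit Types (g C D : 'M[K]_3) (l : 'rV[K]_3) (u v w : 'cV[K]_3) (a b c d : K).

Definition bil D u v : K := (u^T *m D *m v) 0 0.

Lemma bilDr D u v w : bil D u (v + w) = bil D u v + bil D u w.
Proof. by rewrite /bil mulmxDr mxE. Qed.

Lemma bilZr D u c v : bil D u (c *: v) = c * bil D u v.
Proof. by rewrite /bil -scalemxAr mxE. Qed.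

Lemma bil_sym D u v : D^T = D -> bil D u v = bil D v u.
Proof.
move=> DT; rewrite /bil -[in LHS](trmxK (u^T *m D *m v)) mxE.
by rewrite !trmx_mul trmxK DT mulmxA.
Qed.

Lemma bil0r D u : bil D u 0 = 0.
Proof. by rewrite /bil mulmx0 mxE. Qed.

Lemma bil_diag g l v : bil (diag_form g l) v v =
  \sum_k l 0 k * (g^T *m v) k 0 ^+ 2.
Proof.
rewrite /bil /diag_form !mulmxA -[_ *m g^T *m v]mulmxA.
have -> : v^T *m g = (g^T *m v)^T by rewrite trmx_mul trmxK.
by rewrite mxE; apply: eq_bigr => k _; rewrite mul_mx_diag !mxE; ring.
Qed.

Definition inter C D : set (pspace K 2 0) :=
  [set x | (prep x)^T *m C *m prep x = 0 /\ (prep x)^T *m D *m prep x = 0].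

Lemma bil_eq0 D v : v^T *m D *m v = 0 <-> bil D v v = 0.
Proof.
rewrite /bil; split=> [->|h]; first by rewrite mxE.
by apply/matrixP => i j; rewrite !ord1 h mxE.
Qed.

Lemma sqr_eq0_cases (x y : K) : x ^+ 2 = y ^+ 2 -> exists s : bool, x = (-1) ^+ s * y.
Proof.
move=> /eqP; rewrite eqf_sqr => /orP[] /eqP ->; first by exists false; rewrite mul1r.
by exists true; rewrite mulN1r.
Qed.

Lemma sign_inj_mul (s t : bool) (x : K) : x != 0 ->
  (-1) ^+ s * x = (-1) ^+ t * x -> s = t.
Proof.
move=> x0 /(mulIf x0) /eqP; case: s t => [] [] //; rewrite ?expr0 ?expr1.
  by rewrite eq_sym -addr_eq0 -mulr2n pnatr_eq0.
by rewrite -addr_eq0 -mulr2n pnatr_eq0.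
Qed.

(** In the coordinates [y = g^T x] both equations are linear in the squares of the [y_k], which are
    therefore proportional to the cross product of [l] and [(1, 1, 1)], with the differences of
    eigenvalues as entries. Square roots leave four points. *)
Lemma inter_diag_card g l : g \in unitmx -> injective (l 0) ->
  (inter (diag_form g l) (g *m g^T) #= `I_4)%card.
Proof.
move=> gu linj.
pose q0 := sqrtC (l 0 1 - l 0 2); pose q1 := sqrtC (l 0 2 - l 0 0).
pose q2 := sqrtC (l 0 0 - l 0 1).
have lneq i j : i != j -> sqrtC (l 0 i - l 0 j) != 0.
  by move=> ij; rewrite sqrtC_eq0 subr_eq0; apply: contra ij => /eqP/linj ->.
have [q0n q1n q2n] : [/\ q0 != 0, q1 != 0 & q2 != 0] by split; exact: lneq.
have q0E : q0 ^+ 2 = l 0 1 - l 0 2 by exact: sqrtCK.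
have q1E : q1 ^+ 2 = l 0 2 - l 0 0 by exact: sqrtCK.
have q2E : q2 ^+ 2 = l 0 0 - l 0 1 by exact: sqrtCK.
pose Y (s t : bool) : 'cV[K]_3 :=
  \col_k [:: (-1) ^+ s * q0; (-1) ^+ t * q1; q2]`_k.
have Y0 s t : Y s t 0 0 = (-1) ^+ s * q0 by rewrite mxE.
have Y1 s t : Y s t 1 0 = (-1) ^+ t * q1 by rewrite mxE.
have Y2 s t : Y s t 2 0 = q2 by rewrite mxE.
pose h := invmx g^T.
have gTu : g^T \in unitmx by rewrite unitmx_tr.
have hn0 s t : h *m Y s t != 0.
  apply/eqP => /(congr1 (mulmx g^T)); rewrite mulKVmx // mulmx0 => /matrixP/(_ 2 0).
  by rewrite Y2 mxE => /eqP; rewrite (negPf q2n).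
have inE x : inter (diag_form g l) (g *m g^T) x <->
    (let y := g^T *m prep x in
     l 0 0 * y 0 0 ^+ 2 + l 0 1 * y 1 0 ^+ 2 + l 0 2 * y 2 0 ^+ 2 = 0 /\
     y 0 0 ^+ 2 + y 1 0 ^+ 2 + y 2 0 ^+ 2 = 0).
  rewrite /inter /= !bil_eq0 -diag_form1 !bil_diag !big_ord3 !mxE !mul1r.
  by [].
(* The two bits of [i] are the signs of the first two coordinates; the sign of the third is spent on
   projective scaling. *)
pose f (i : nat) := pclass (h *m Y (odd i) (1 < i)%N).
have -> : inter (diag_form g l) (g *m g^T) = f @` `I_4.
  apply/seteqP; split=> [x /inE /=|_ [i _ <-]]; last first.
    apply/inE => /=; rewrite /f.
    have [c c0 ->] := prep_pclass (hn0 (odd i) (1 < i)%N).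
    have cY k : (c *: Y (odd i) (1 < i)%N) k 0 = c * Y (odd i) (1 < i)%N k 0.
      by rewrite [LHS]mxE.
    rewrite -scalemxAr mulKVmx // !cY Y0 Y1 Y2.
    by rewrite !exprMn !sqrr_sign !mul1r q0E q1E q2E; split; ring.
  set y := g^T *m prep x => -[y1 y2].
  have y0 : y != 0.
    by rewrite /y; apply: contra (prep_neq0 x) => /eqP/(congr1 (mulmx h));
      rewrite mulKmx // mulmx0 => ->.
  pose k := y 2 0 / q2.
  have k2 : y 2 0 = k * q2 by rewrite /k divfK.
  have k0 : y 0 0 ^+ 2 = (k * q0) ^+ 2.
    apply: (mulIf (expf_neq0 2 q2n)).
    rewrite (_ : (k * q0) ^+ 2 * _ = (k * q2) ^+ 2 * q0 ^+ 2); last by ring.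
    rewrite -k2 q0E q2E.
    apply/eqP; rewrite -subr_eq0; apply/eqP.
    transitivity ((l 0 0 * y 0 0 ^+ 2 + l 0 1 * y 1 0 ^+ 2 + l 0 2 * y 2 0 ^+ 2) -
      l 0 1 * (y 0 0 ^+ 2 + y 1 0 ^+ 2 + y 2 0 ^+ 2)); first ring.
    by rewrite y1 y2 mulr0 subrr.
  have k1 : y 1 0 ^+ 2 = (k * q1) ^+ 2.
    apply: (mulIf (expf_neq0 2 q2n)).
    rewrite (_ : (k * q1) ^+ 2 * _ = (k * q2) ^+ 2 * q1 ^+ 2); last by ring.
    rewrite -k2 q1E q2E.
    apply/eqP; rewrite -subr_eq0; apply/eqP.
    transitivity (l 0 0 * (y 0 0 ^+ 2 + y 1 0 ^+ 2 + y 2 0 ^+ 2) -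
     (l 0 0 * y 0 0 ^+ 2 + l 0 1 * y 1 0 ^+ 2 + l 0 2 * y 2 0 ^+ 2)); first ring.
    by rewrite y1 y2 mulr0 subrr.
  have [s sE] := sqr_eq0_cases k0; have [t tE] := sqr_eq0_cases k1.
  have yE : y = k *: Y s t.
    apply/colP; apply: forall_ord3; rewrite [RHS]mxE ?Y0 ?Y1 ?Y2 //.
      by rewrite sE mulrCA.
    by rewrite tE mulrCA.
  have kn0 : k != 0 by apply: contraNneq y0 => kk; rewrite yE kk scale0r.
  exists (s + t.*2)%N; first by case: (s); case: (t).
  have -> : f (s + t.*2)%N = pclass (h *m Y s t) by rewrite /f; case: (s); case: (t).
  rewrite -(pclassZ _ kn0) scalemxAr -yE /y mulKmx //; exact: prepK.
apply: inj_card_eq => i j; rewrite !in_setE /= => i4 j4.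
move=> /pclassP[]; rewrite ?hn0 // => c c0; rewrite scalemxAr => /(congr1 (mulmx g^T)).
rewrite !mulKVmx // => YE.
have c1 : c = 1.
  have /matrixP/(_ 2 0) := YE; rewrite [RHS]mxE !Y2 -[LHS]mul1r.
  by move=> /(mulIf q2n).
have e0 : odd j = odd i.
  have /matrixP/(_ 0 0) := YE; rewrite c1 scale1r !Y0; exact: sign_inj_mul.
have e1 : (1 < j)%N = (1 < i)%N.
  have /matrixP/(_ 1 0) := YE; rewrite c1 scale1r !Y1; exact: sign_inj_mul.
by move: i j i4 j4 e0 e1 {YE} => [|[|[|[|//]]]] [|[|[|[|//]]]].
Qed.

Lemma bilDl D u v w : bil D (u + v) w = bil D u w + bil D v w.
Proof. by rewrite /bil linearD /= !mulmxDl mxE. Qed.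

Lemma bilZl D c u v : bil D (c *: u) v = c * bil D u v.
Proof. by rewrite /bil linearZ /= -!scalemxAl mxE. Qed.

(* Three points of a non-degenerate conic are not collinear. *)
Lemma isotropic_free D u v w : D^T = D -> \det D != 0 ->
  u != 0 -> v != 0 -> w != 0 ->
  (forall c, v != c *: u) -> (forall c, w != c *: u) -> (forall c, w != c *: v) ->
  bil D u u = 0 -> bil D v v = 0 -> bil D w w = 0 ->
  forall a b c, a *: u + b *: v + c *: w = 0 -> [/\ a = 0, b = 0 & c = 0].
Proof.
move=> DT D0 u0 v0 w0 uv uw vw Du Dv Dw a b c E.
have two (x y : 'cV[K]_3) p q : x != 0 -> (forall c, y != c *: x) ->
    p *: x + q *: y = 0 -> p = 0 /\ q = 0.
  move=> x0 xy; have [->|q0] := eqVneq q 0.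
    by rewrite scale0r addr0 => /eqP; rewrite scaler_eq0 (negPf x0) orbF => /eqP.
  rewrite addrC => /eqP; rewrite addr_eq0 => /eqP /(congr1 (fun z => q^-1 *: z)).
  rewrite scalerA mulVf // scale1r -scaleNr scalerA => /eqP.
  by rewrite (negPf (xy _)).
have [a0|a0] := eqVneq a 0.
  by move: E; rewrite a0 scale0r add0r => /two[]// -> ->.
have [b0|b0] := eqVneq b 0.
  by move: E; rewrite b0 scale0r addr0 => /two[]// -> ->.
have [c0|c0] := eqVneq c 0.
  by move: E; rewrite c0 scale0r addr0 => /two[]// -> ->.
have BE x : a * bil D x u + b * bil D x v + c * bil D x w = 0.
  by rewrite -!bilZr -!bilDr E bil0r.
have := BE u; have := BE v; have := BE w.
rewrite Du Dv Dw (bil_sym w u DT) (bil_sym w v DT) (bil_sym v u DT).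
rewrite !mulr0 !addr0 !add0r => e1 e2 e3.
(* Pairing the relation with each of the three vectors gives a linear system for the mutual
   products, which forces [2 a b D(u, v) = 0]. *)
have Duv : bil D u v = 0.
  apply/eqP; have : 2 * a * b * bil D u v == 0.
    rewrite (_ : _ * _ = a * (b * bil D u v + c * bil D u w)
      + b * (a * bil D u v + c * bil D v w) - c * (a * bil D u w + b * bil D v w)).
      by rewrite e1 e2 e3 !mulr0 addr0 subrr.
    ring.
  by rewrite !mulf_eq0 pnatr_eq0 (negPf a0) (negPf b0).
(* Now [u] and [v] span a totally isotropic plane, which a non-degenerate form in three variables
   does not admit: two ranks equal to 2 would sum to at most 3. *)
pose P := row_mx u v.
have PP : P^T *m D *m P = 0.
  rewrite tr_row_mx mul_col_mx mul_col_row.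
  have z (x y : 'cV[K]_3) : bil D x y = 0 -> x^T *m D *m y = 0.
    by move=> h; apply/matrixP => i j; rewrite !ord1 [RHS]mxE; exact: h.
  by rewrite !z ?(bil_sym v u DT) // block_mx0.
have rP : \rank P^T = 2%N.
  apply/eqP; apply: inj_row_free => z zP.
  have := hsubmxK z; set z1 := lsubmx z; set z2 := rsubmx z => zE.
  move: zP; rewrite -zE tr_row_mx mul_row_col => zP.
  have := congr1 trmx zP; rewrite trmx0 linearD /= !trmx_mul !trmxK.
  rewrite (mx11_scalar z1) (mx11_scalar z2) !tr_scalar_mx !mul_mx_scalar.
  move=> /two[]// -> ->.
  by rewrite -scalemx1 scale0r row_mx0.
have Du' : D \in unitmx by rewrite unitmxE unitfE.
have := mulmx0_rank_max PP; rewrite mxrankMfree; last by rewrite row_free_unit.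
by rewrite rP -[\rank P]mxrank_tr rP.
Qed.

(** The columns [(0,1,1)], [(1,0,1)], [(1,1,0)] are the diagonal points of the quadrangle
    [e_0, e_1, e_2, (1,1,1)], that is, the vertices of the triangle self-polar for the conics
    through these four points. *)
Definition offdiag3 : 'M[K]_3 := \matrix_(i, j) (i != j)%:R.

Lemma offdiag3_unit : offdiag3 \in unitmx.
Proof.
(* The matrix is [J - 1] with [J] the all-ones matrix; from [J^2 = 3 J] its inverse is
   [(J - 2) / 2]. *)
suff E : offdiag3 *m (2^-1 *: \matrix_(i, j) (1 - 2 * (i == j)%:R)) = 1%:M.
  by case/mulmx1_unit: E.
rewrite -scalemxAr; apply/matrixP; apply: forall_ord3; apply: forall_ord3;
  rewrite !mxE big_ord3 !mxE /=; field; rewrite ?pnatr_eq0 //.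
Qed.

(* Conics through the points [e_0, e_1, e_2] and [(1, 1, 1)] are diagonal
   in the basis of the columns of [offdiag3]. *)
Lemma offdiag3_diag (A : 'M[K]_3) : A^T = A -> (forall i, A i i = 0) ->
  \sum_i \sum_j A i j = 0 ->
  exists2 a : 'rV[K]_3, offdiag3^T *m A *m offdiag3 = diag_mx a & \sum_i a 0 i = 0.
Proof.
move=> AT Ad; rewrite !big_ord3 !Ad /=.
have s i j : A j i = A i j by rewrite -[in LHS]AT mxE.
rewrite !(s 0 1) !(s 0 2) !(s 1 2) => A0.
exists (2 *: \row_k [:: A 1 2; A 0 2; A 0 1]`_k); last first.
  rewrite big_ord3 !mxE /=; rewrite -[RHS]A0; ring.
have {}A0 : A 1 2 = - A 0 1 - A 0 2.
  apply/eqP; rewrite -subr_eq0; apply/eqP.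
  by apply: (@mulfI _ 2); rewrite ?pnatr_eq0 // mulr0 -A0; ring.
apply/matrixP; apply: forall_ord3; apply: forall_ord3;
  by rewrite !mxE !big_ord3 !mxE !big_ord3 !mxE !Ad !(s 0 1) !(s 0 2) !(s 1 2) /= A0; ring.
Qed.

Lemma big_ord3_shift (k : 'I_3) (F : 'I_3 -> K) :
  \sum_i F i = F k + F (k + 1) + F (k + 2).
Proof.
rewrite big_ord3; move: k; apply: forall_ord3.
- by congr (F _ + F _ + F _); apply: val_inj.
- by rewrite addrC addrA; congr (F _ + F _ + F _); apply: val_inj.
- by rewrite -addrA addrC; congr (F _ + F _ + F _); apply: val_inj.
Qed.

Lemma ord3_other (i j k : 'I_3) : k != i -> k != j -> i != j ->
  i = k + 1 /\ j = k + 2 \/ i = k + 2 /\ j = k + 1.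
Proof.
rewrite ![k == _]eq_sym => /ord3_neq[] -> /ord3_neq[] ->; rewrite ?eqxx // => _.
  by left.
by right.
Qed.

(** The cardinality enters twice: the four points provide the projective frame, and the absence of a
    fifth makes the ratios of eigenvalues distinct. *)
Lemma inter_card_diag C D : C^T = C -> D^T = D ->
  \det C != 0 -> \det D != 0 -> (inter C D #= `I_4)%card ->
  exists g l, [/\ g \in unitmx, injective (l 0), forall k, l 0 k != 0,
    C = diag_form g l & D = g *m g^T].
Proof.
move=> CT DT C0 D0 /card_set_bijP[f [ffun finj fsurj]].
have ptP i : exists x, (i < 4)%N -> inter C D x /\ f x = i.
  case: (ltnP i 4) => [i4|_]; last by exists (pclass 0).
  by have [x ix fx] := fsurj i i4; exists x.
have /choice[P PP] := ptP.
pose x i := prep (P i).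
have x0 i : x i != 0 := prep_neq0 _.
have xneq i j : (i < 4)%N -> (j < 4)%N -> i != j -> forall c, x j != c *: x i.
  move=> i4 j4 ij c; apply: contra ij => /eqP E.
  have c0 : c != 0 by apply: contraNneq (x0 j) => c0; rewrite E c0 scale0r.
  have : P i = P j by rewrite -[LHS]prepK -[RHS]prepK -/(x i) -/(x j) E pclassZ.
  by move=> /(congr1 f); rewrite (PP i i4).2 (PP j j4).2 => ->.
have xC i : (i < 4)%N -> bil C (x i) (x i) = 0 by move=> /PP[[+ _] _] => /bil_eq0.
have xD i : (i < 4)%N -> bil D (x i) (x i) = 0 by move=> /PP[[_ +] _] => /bil_eq0.
have free i j k : (i < 4)%N -> (j < 4)%N -> (k < 4)%N -> i != j -> i != k -> j != k ->
    forall a b c, a *: x i + b *: x j + c *: x k = 0 -> [/\ a = 0, b = 0 & c = 0].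
  by move=> i4 j4 k4 ij ik jk; apply: (isotropic_free DT D0) => //; auto.
pose A : 'M[K]_3 := \matrix_(i, j) x j i 0.
have AE (u : 'cV[K]_3) : A *m u = u 0 0 *: x 0%N + u 1 0 *: x 1%N + u 2 0 *: x 2%N.
  by apply/colP => i; rewrite !mxE big_ord3 !mxE /=; ring.
have Au : A \in unitmx.
  rewrite -unitmx_tr -row_free_unit; apply: inj_row_free => v /(congr1 trmx).
  rewrite trmx_mul trmxK trmx0 AE => /free[]// ; rewrite !mxE => v0 v1 v2.
  by apply/rowP; apply: forall_ord3; rewrite !mxE.
(* Coordinates of the fourth point on the first three. Freeness makes them all non-zero, so
   rescaling the columns of [A] by them gives a frame in which the fourth point is [(1, 1, 1)]. *)
pose v := invmx A *m x 3%N.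
have x3E : x 3%N = v 0 0 *: x 0%N + v 1 0 *: x 1%N + v 2 0 *: x 2%N.
  by rewrite -AE mulKVmx.
have vn0 : forall k, v k 0 != 0.
  have n1 : (-1 : K) != 0 by rewrite oppr_eq0 oner_eq0.
  apply: forall_ord3; apply: contra_neq n1 => vk; move: x3E; rewrite vk scale0r ?addr0 ?add0r.
  - move=> E; have [|_ _ //] := @free 1%N 2%N 3%N isT isT isT isT isT isT (v 1 0) (v 2 0) (-1).
    by rewrite scaleN1r E subrr.
  - move=> E; have [|_ _ //] := @free 0%N 2%N 3%N isT isT isT isT isT isT (v 0 0) (v 2 0) (-1).
    by rewrite scaleN1r E subrr.
  - move=> E; have [|_ _ //] := @free 0%N 1%N 3%N isT isT isT isT isT isT (v 0 0) (v 1 0) (-1).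
    by rewrite scaleN1r E subrr.
pose B := A *m diag_mx v^T.
have Bu : B \in unitmx.
  rewrite unitmx_mul Au /= unitmxE unitfE det_diag; apply/prodf_neq0 => i _.
  by rewrite mxE.
have bilB N i j : (B^T *m N *m B) i j = v i 0 * v j 0 * bil N (x i) (x j).
  have BE k : col k B = v k 0 *: x k.
    by apply/colP => u; rewrite [LHS]mxE /B mul_mx_diag !mxE mulrC.
  transitivity (bil N (col i B) (col j B)); last by rewrite !BE bilZl bilZr mulrA.
  rewrite /bil tr_col -row_mul [LHS]mxE [RHS]mxE; apply: eq_bigr => k _.
  by rewrite [row _ _ _ _]mxE [col _ _ _ _]mxE.
have normal N : N^T = N -> (forall i, (i < 4)%N -> bil N (x i) (x i) = 0) ->
    exists2 a : 'rV[K]_3, offdiag3^T *m (B^T *m N *m B) *m offdiag3 = diag_mx a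
      & \sum_i a 0 i = 0.
  move=> NT Nx; apply: offdiag3_diag.
  - have cs (M : 'M[K]_3) : (M^T *m N *m M)^T = M^T *m N *m M.
      by rewrite !trmx_mul trmxK NT mulmxA.
    exact: cs.
  - by move=> i; rewrite bilB Nx ?mulr0 // ltnS ltnW.
  - transitivity (bil N (x 3%N) (x 3%N)); last by rewrite Nx.
    rewrite x3E !(bilDl, bilDr, bilZl, bilZr) !big_ord3 !bilB /=; ring.
have [a Ca sa] := normal _ CT xC; have [d Dd sd] := normal _ DT xD.
pose H := B *m offdiag3.
have Hu : H \in unitmx by rewrite unitmx_mul Bu offdiag3_unit.
pose g0 := invmx H^T.
have g0u : g0 \in unitmx by rewrite unitmx_inv unitmx_tr.
have g0E N (b : 'rV[K]_3) : offdiag3^T *m (B^T *m N *m B) *m offdiag3 = diag_mx b ->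
    N = diag_form g0 b.
  rewrite /diag_form => <-; rewrite (_ : _ *m offdiag3 = H^T *m N *m H); last first.
    have cs (M S : 'M[K]_3) : S^T *m (M^T *m N *m M) *m S = (M *m S)^T *m N *m (M *m S).
      by rewrite trmx_mul !mulmxA.
    exact: cs.
  have cs2 (M : 'M[K]_3) : M \in unitmx ->
      invmx M^T *m (M^T *m N *m M) *m (invmx M^T)^T = N.
    move=> Mu; rewrite trmx_inv trmxK -!mulmxA mulKmx ?unitmx_tr //.
    by rewrite mulmxV // mulmx1.
  by rewrite /g0 cs2.
have CE := g0E _ _ Ca; have DE := g0E _ _ Dd.
have an0 : forall k, a 0 k != 0.
  move: C0; rewrite CE det_diag_form mulf_eq0 negb_or => /andP[_ /prodf_neq0 h] k.
  exact: h.
have dn0 : forall k, d 0 k != 0.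
  move: D0; rewrite DE det_diag_form mulf_eq0 negb_or => /andP[_ /prodf_neq0 h] k.
  exact: h.
pose r := \row_k sqrtC (d 0 k).
pose l := \row_k (a 0 k / d 0 k).
exists (g0 *m diag_mx r), l; split.
- rewrite unitmx_mul g0u unitmxE unitfE det_diag; apply/prodf_neq0 => i _.
  by rewrite mxE sqrtC_eq0.
(* Both diagonals have sum 0, so one equality of ratios spreads to the third index and makes [C]
   proportional to [D]: the intersection would be a whole conic. *)
- move=> i j; rewrite !mxE => lij; apply/eqP; apply: contraT => ij.
  have [lam lamE] : exists lam, forall k, a 0 k = lam * d 0 k.
    exists (a 0 i / d 0 i) => k.
    have [->|ki] := eqVneq k i; first by rewrite divfK.
    have [->|kj] := eqVneq k j; first by rewrite lij divfK.
    have kij : i = k + 1 /\ j = k + 2 \/ i = k + 2 /\ j = k + 1.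
      exact: ord3_other.
    have sum3 (b : 'rV[K]_3) : \sum_i b 0 i = 0 -> b 0 k = - (b 0 i + b 0 j).
      rewrite (big_ord3_shift k) -addrA => /eqP; rewrite addr_eq0 => /eqP ->.
      by case: kij => -[-> ->] //; rewrite addrC.
    by rewrite !sum3 // mulrN mulrDr {2}lij !divfK.
  have CD : C = lam *: D.
    rewrite CE DE -diag_formZ; congr (diag_form _ _).
    by apply/rowP => k; rewrite lamE mxE.
  (* A fifth common point: in the frame its coordinates are [(y_1 + y_2, y_2, y_1)] with [y_1] and
     [y_2] non-zero, so it is none of [e_0], [e_1], [e_2], [(1, 1, 1)]. *)
  pose y : 'cV[K]_3 := \col_k [:: 0; sqrtC (- d 0 2); sqrtC (d 0 1)]`_k.
  have y1 : y 1 0 != 0 by rewrite mxE sqrtC_eq0 oppr_eq0.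
  have y2 : y 2 0 != 0 by rewrite mxE sqrtC_eq0.
  have yn0 : H *m y != 0.
    apply/eqP => /(congr1 (mulmx (invmx H))); rewrite mulKmx // mulmx0 => h.
    by rewrite h mxE eqxx in y1.
  have yD : bil D (H *m y) (H *m y) = 0.
    rewrite DE bil_diag big_ord3 /g0 trmx_inv trmxK mulKmx // !mxE /=.
    by rewrite !sqrtCK; ring.
  have yC : bil C (H *m y) (H *m y) = 0.
    by rewrite CD /bil -scalemxAr -scalemxAl mxE -/(bil _ _ _) yD mulr0.
  have [c c0 cE] := prep_pclass yn0.
  have yI : inter C D (pclass (H *m y)).
    by split; apply/bil_eq0; rewrite cE bilZl bilZr ?yC ?yD !mulr0.
  have f5 : (f (pclass (H *m y)) < 4)%N by exact: ffun.
  have [I5 E5] := PP _ f5.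
  have PE : P (f (pclass (H *m y))) = pclass (H *m y).
    by apply: finj; rewrite ?in_setE.
  have {PE I5 E5 cE}xE : x (f (pclass (H *m y))) = c *: (H *m y) by rewrite /x PE.
  have [k k3 xk] : exists2 k, (k < 4)%N & x k = A *m (c *: (diag_mx v^T *m (offdiag3 *m y))).
    by exists (f (pclass (H *m y))) => //; rewrite xE -scalemxAr /H /B !mulmxA.
  have oE : offdiag3 *m y = \col_k [:: y 1 0 + y 2 0; y 2 0; y 1 0]`_k.
    have yy0 : y 0 0 = 0 by rewrite mxE.
    apply/colP; apply: forall_ord3; rewrite [LHS]mxE big_ord3 yy0 [RHS]mxE !mxE /=; ring.
  have wE k' : (c *: (diag_mx v^T *m (offdiag3 *m y))) k' 0
      = c * (v k' 0 * [:: y 1 0 + y 2 0; y 2 0; y 1 0]`_k').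
    by rewrite oE mul_diag_mx !mxE.
  set w := c *: _ in xk wE.
  have w1 : w 1 0 != 0 by rewrite wE !mulf_neq0.
  have w2 : w 2 0 != 0 by rewrite wE !mulf_neq0.
  have wE' (u : 'cV[K]_3) : A *m u = x k -> w = u.
    by move=> h; rewrite -[w](mulKmx Au) -xk -h mulKmx.
  clearbody w; move: k3 wE' {xk}; case: k => [|[|[|[|//]]]] _ wE'.
  - move: w1; rewrite (wE' (delta_mx 0 0)) ?mxE ?eqxx // AE !mxE /=.
    by rewrite scale1r !scale0r !addr0.
  - move: w2; rewrite (wE' (delta_mx 1 0)) ?mxE ?eqxx // AE !mxE /=.
    by rewrite scale1r !scale0r addr0 add0r.
  - move: w1; rewrite (wE' (delta_mx 2 0)) ?mxE ?eqxx // AE !mxE /=.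
    by rewrite scale1r !scale0r !add0r.
  - have wv : w = v by apply: wE'; rewrite mulKVmx.
    have := wE 0; have := wE 1; rewrite wv /= => /eqP; rewrite -subr_eq0 => /eqP e1 /eqP.
    rewrite -subr_eq0 => /eqP e0.
    have : v 0 0 * v 1 0 * c * y 1 0 = 0.
      transitivity (v 0 0 * (v 1 0 - c * (v 1 0 * y 2 0))
         - v 1 0 * (v 0 0 - c * (v 0 0 * (y 1 0 + y 2 0)))); first ring.
      by rewrite e0 e1 !mulr0 subrr.
    by move/eqP; rewrite !mulf_eq0 (negPf c0) (negPf y1) !(negPf (vn0 _)).
- by move=> k; rewrite mxE mulf_neq0 ?invr_eq0.
- rewrite CE diag_form_scale_col; congr (diag_form _ _); apply/rowP => k.
  by rewrite !mxE sqrtCK mulrC divfK.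
- rewrite -diag_form1 DE diag_form_scale_col; congr (diag_form _ _); apply/rowP => k.
  by rewrite !mxE sqrtCK mulr1.
Qed.

End Transversality.

(** * The equation [j = b] *)

Section Branches.
Variable K : numClosedFieldType.
Implicit Types p q : {poly K}.

Lemma prod_XsubC_double_root (s : seq K) : ~~ uniq s ->
  exists2 z, root (\prod_(x <- s) ('X - x%:P)) z
    & root (\prod_(x <- s) ('X - x%:P))^`() z.
Proof.
elim: s => //= a s IH; rewrite negb_and negbK big_cons => /orP[as_|/IH[z rz dz]].
  exists a; first by rewrite rootM root_XsubC eqxx.
  rewrite derivM derivXsubC mul1r rootE hornerD hornerM hornerXsubC subrr mul0r.
  by rewrite addr0 -rootE root_prod_XsubC.
exists z; first by rewrite rootM rz orbT.
rewrite derivM derivXsubC mul1r rootE hornerD hornerM.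
by rewrite (rootP rz) (rootP dz) mulr0 addr0.
Qed.

Lemma simple_roots p n : size p = n.+1 ->
  (forall z, root p z -> p^`().[z] != 0) ->
  exists2 r : 'I_n -> K, injective r & forall i, root p (r i).
Proof.
move=> sp dp; have [rs pE] := closed_field_poly_normal p.
have p0 : lead_coef p != 0 by rewrite lead_coef_eq0 -size_poly_eq0 sp.
have srs : size rs = n.
  by move: sp; rewrite pE size_scale // size_prod_XsubC => -[].
have urs : uniq rs.
  apply: contraT => /prod_XsubC_double_root[z rz /rootP dz].
  have := dp z; rewrite pE rootZ // derivZ hornerZ dz mulr0 eqxx.
  by move=> /(_ rz).
exists (fun i : 'I_n => rs`_i).
  by move=> i j /eqP; rewrite nth_uniq ?srs // => /eqP/val_inj.
move=> i; rewrite pE rootZ // root_prod_XsubC; apply: mem_nth; by rewrite srs.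
Qed.

(** The branches through the [n] simple roots at [t0] stay distinct nearby by continuity. As the
    degree is locally constant, they exhaust the roots: none comes in from infinity. *)
Lemma simple_branches p q n (t0 : K) :
  (\forall t \near t0, size (p - t *: q) = n.+1) ->
  (forall z, root (p - t0 *: q) z -> p^`().[z] - t0 * q^`().[z] != 0) ->
  exists r : 'I_n -> K -> K, \forall t \near t0,
    [/\ forall i, differentiable (r i) t,
        forall i, root (p - t *: q) (r i t), injective (r^~ t)
      & forall z, root (p - t *: q) z -> exists i, z = r i t].
Proof.
move=> sP dP; have [r0 r0inj r0root] : exists2 r : 'I_n -> K, injective r &
    forall i, root (p - t0 *: q) (r i).
  apply: simple_roots; first exact: nbhs_singleton sP.
  by move=> z /dP; rewrite derivB derivZ !hornerE.
have /choice[r rP] : forall i, exists r : K -> K, r t0 = r0 i /\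
    \forall t \near t0, differentiable r t /\ p.[r t] = t * q.[r t].
  move=> i; have ri := r0root i.
  have [] := @root_branch _ p q (r0 i) t0.
  - by move/rootP: ri; rewrite !hornerE => /eqP; rewrite subr_eq0 => /eqP.
  - exact: dP.
  - by move=> r; exists r.
exists r.
have near1 : \forall t \near t0, forall i, differentiable (r i) t /\ p.[r i t] = t * q.[r i t].
  apply: (@filter_forall _ _
    (fun i t => differentiable (r i) t /\ p.[r i t] = t * q.[r i t]) _ (nbhs_filter t0)) => i.
  exact: (rP i).2.
have near2 : \forall t \near t0, forall i j, i != j -> r i t != r j t.
  apply: (@filter_forall _ _ (fun i t => forall j, i != j -> r i t != r j t)
    _ (nbhs_filter t0)) => i.
  apply: (@filter_forall _ _ (fun j t => i != j -> r i t != r j t) _ (nbhs_filter t0)) => j.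
  have [->|ij] := eqVneq i j; first by near=> t.
  have ci k : {for t0, continuous (r k)}.
    by apply: differentiable_continuous; have := nbhs_singleton (rP k).2 => -[].
  have c : r i t - r j t @[t --> t0] --> r i t0 - r j t0 by exact: (cvgB (ci i) (ci j)).
  have n0 : r i t0 - r j t0 != 0.
    by rewrite (rP i).1 (rP j).1 subr_eq0; apply: contra ij => /eqP/r0inj ->.
  by apply: filterS (cvgr_neq0 _ c n0) => t; rewrite subr_eq0.
apply: filterS3 sP near1 near2 => t st rt nt.
have rroot i : root (p - t *: q) (r i t).
  by rewrite rootE !hornerE (rt i).2 subrr.
have rinj : injective (r^~ t).
  by move=> i j rij; apply/eqP; apply: contraT => /nt; rewrite rij eqxx.
split=> // [i|z rz]; first by have [] := rt i.
apply: contrapT => nz.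
have P0 : p - t *: q != 0 by rewrite -size_poly_eq0 st.
have all_r : all (root (p - t *: q)) [seq r i t | i : 'I_n].
  by apply/allP => _ /mapP[i _ ->].
have uniq_r : uniq [seq r i t | i : 'I_n] by rewrite map_inj_uniq ?enum_uniq.
have := @max_poly_roots _ _ (z :: [seq r i t | i : 'I_n]) P0.
rewrite /= rz all_r uniq_r size_map -cardE card_ord st ltnn andbT => /(_ isT) h.
have : z \in [seq r i t | i : 'I_n].
  by apply: contraT => zn; apply: h; rewrite zn.
by move=> /mapP[i _ zi]; apply: nz; exists i.
Unshelve. all: by end_near.
Qed.

Definition numj (s : K) : K := 256 * (1 - 6 * s) ^+ 3.
(** It vanishes exactly when [X (X - 1)^2 - s] has a multiple root, the discriminant of this cubic
    being [s (4 - 27 s)]. *)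
Definition denj (s : K) : K := s ^+ 3 * (4 - 27 * s).

(* The factor [27 s^2 - 18 s + 2] comes from
   [256 (1 - 6 s)^3 - 1728 s^3 (4 - 27 s) = 64 (27 s^2 - 18 s + 2)^2]. *)
Lemma j_equation_simple (b s : K) : b != 0 -> b != 1728 -> numj s = b * denj s ->
  [/\ s != 0, 4 - 27 * s != 0
    & - (4608 * (1 - 6 * s) ^+ 2) - b * (12 * s ^+ 2 - 108 * s ^+ 3) != 0].
Proof.
rewrite /numj /denj => b0 b1 E.
have nat0 n : (n.+1%:R : K) != 0 by rewrite pnatr_eq0.
have s0 : s != 0.
  apply/eqP => s0; move: E; rewrite s0 mulr0 subr0 expr1n expr0n /= mul0r mulr0 mulr1.
  by move/eqP; rewrite (negPf (nat0 _)).
have s4 : 4 - 27 * s != 0.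
  apply/eqP => s4; move: E; rewrite s4 !mulr0 => /eqP.
  rewrite mulf_eq0 (negPf (nat0 _)) expf_eq0 /= => /eqP s6.
  have : (1 : K) = 0.
    transitivity (9 * (1 - 6 * s) - 2 * (4 - 27 * s)); first ring.
    by rewrite s4 s6 !mulr0 subrr.
  by move/eqP; rewrite oner_eq0.
split; [exact: s0|exact: s4|apply/eqP => D].
have s6 : 1 - 6 * s != 0.
  apply/eqP => s6; move: E; rewrite s6 expr0n /= mulr0 => /esym/eqP.
  by rewrite !mulf_eq0 (negPf b0) (negPf s4) ?expf_eq0 (negPf s0).
have n1536 : (1536 : K) != 0 by rewrite pnatr_eq0.
(* Eliminating [b] between the equation and its derivative leaves the Wronskian of [numj] and
   [denj], which up to sign is [1536 s^2 (1 - 6 s)^2 (27 s^2 - 18 s + 2)]. *)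
have q0 : 27 * s ^+ 2 - 18 * s + 2 = 0.
  apply: (mulfI (expf_neq0 2 s6)); apply: (mulfI n1536); rewrite !mulr0.
  transitivity
    (12 * (1 - 9 * s) * (256 * (1 - 6 * s) ^+ 3 - b * (s ^+ 3 * (4 - 27 * s)))
     - s * (4 - 27 * s) *
       (- (4608 * (1 - 6 * s) ^+ 2) - b * (12 * s ^+ 2 - 108 * s ^+ 3))).
    ring.
  by rewrite D E subrr !mulr0 subrr.
have : (1728 - b) * (s ^+ 3 * (4 - 27 * s)) = 0.
  transitivity (256 * (1 - 6 * s) ^+ 3 - b * (s ^+ 3 * (4 - 27 * s))
    - 64 * (27 * s ^+ 2 - 18 * s + 2) ^+ 2); first ring.
  by rewrite E q0 subrr expr0n /= mulr0 subrr.
move/eqP; rewrite !mulf_eq0 (negPf s4) ?expf_eq0 (negPf s0) subr_eq0 eq_sym.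
by rewrite (negPf b1).
Qed.

Definition numj_poly : {poly K} :=
  256%:P * ((1%:P - 6%:P * 'X) * (1%:P - 6%:P * 'X) * (1%:P - 6%:P * 'X)).
Definition denj_poly : {poly K} := 'X * 'X * 'X * (4%:P - 27%:P * 'X).

Lemma horner_numj s : numj_poly.[s] = numj s.
Proof. by rewrite /numj_poly /numj !hornerE; ring. Qed.

Lemma horner_denj s : denj_poly.[s] = denj s.
Proof. by rewrite /denj_poly /denj !hornerE; ring. Qed.

(** The leading coefficient is [27 b]: at [b = 0] a root escapes to infinity. *)
Lemma size_j_equation b : b != 0 -> size (numj_poly - b *: denj_poly) = 5%N.
Proof.
move=> b0.
have -> : numj_poly - b *: denj_poly =
  Poly [:: 256; - (256 * 18); 256 * 108; - (256 * 216) - 4 * b; 27 * b].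
  rewrite /numj_poly /denj_poly /= !cons_poly_def -mul_polyC.
  rewrite !(rmorphB, rmorphN, rmorphM) /=; ring.
by rewrite (@PolyK _ 1) //= mulf_neq0 // pnatr_eq0.
Qed.

Definition cubic_poly : {poly K} := 'X * (('X - 1%:P) * ('X - 1%:P)).

Lemma size_cubic s : size (cubic_poly - s *: 1) = 4%N.
Proof.
have -> : cubic_poly - s *: 1 = Poly [:: - s; 1; - 2; 1].
  rewrite /cubic_poly /= !cons_poly_def -mul_polyC rmorphN; ring.
by rewrite (@PolyK _ 1) //= oner_neq0.
Qed.

Lemma cubic_esym (s : K) (l : 'rV[K]_3) : injective (l 0) ->
  (forall k, l 0 k * (l 0 k - 1) ^+ 2 = s) ->
  [/\ esym1 l = 2, esym2 l = 1 & esym3 l = s].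
Proof.
move=> linj h; rewrite /esym1 /esym2 /esym3.
have n i j : i != j -> l 0 i - l 0 j != 0.
  by rewrite subr_eq0; apply: contra => /eqP/linj ->.
(* Difference of the equations at [i] and [j], divided by [l 0 i - l 0 j]; a second such division
   yields the sum of the roots. *)
have A i j : i != j -> l 0 i ^+ 2 + l 0 i * l 0 j + l 0 j ^+ 2
    - 2 * (l 0 i + l 0 j) + 1 = 0.
  move=> /n ij; apply: (mulfI ij); rewrite mulr0 -[RHS](subrr s) -{1}(h i) -(h j).
  ring.
have e1 : l 0 0 + l 0 1 + l 0 2 = 2.
  apply/eqP; rewrite -subr_eq0; apply/eqP; apply: (mulfI (n 1 2 isT)).
  by rewrite mulr0 -[RHS](subrr 0) -{1}(A 0 1 isT) -(A 0 2 isT); ring.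
have l01 : l 0 0 * l 0 1 = (l 0 2 - 1) ^+ 2.
  have e1' : l 0 0 = 2 - l 0 1 - l 0 2 by rewrite -e1; ring.
  apply/eqP; rewrite -subr_eq0; apply/eqP; rewrite -oppr0 -(A 0 1 isT) e1'; ring.
have e2 : l 0 0 + l 0 1 = 2 - l 0 2 by rewrite -e1; ring.
split=> //; last by rewrite l01 mulrC h.
by rewrite l01 -addrA -mulrDl e2; ring.
Qed.

Lemma horner_cubic s x : (cubic_poly - s *: 1).[x] = x * (x - 1) ^+ 2 - s.
Proof. by rewrite /cubic_poly !hornerE; ring. Qed.

Lemma cubic_branches (s0 : K) : s0 != 0 -> 4 - 27 * s0 != 0 ->
  exists r : K -> 'rV[K]_3, \forall s \near s0,
    [/\ differentiable r s, injective (r s 0)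
      & forall k, r s 0 k * (r s 0 k - 1) ^+ 2 = s].
Proof.
move=> s0n s04; have [||r rP] := @simple_branches cubic_poly 1 3 s0.
- by near=> s; exact: size_cubic.
- move=> z /rootP; rewrite horner_cubic => /eqP; rewrite subr_eq0 => /eqP zs.
  (* The critical points 1 and 1/3 have critical values 0 and 4/27, the two values excluded for
     [s0]. *)
  have -> : cubic_poly^`().[z] - s0 * (1 : {poly K})^`().[z] = (z - 1) * (3 * z - 1).
    rewrite /cubic_poly !(derivM, derivB, derivX, derivC) !hornerE; ring.
  apply: mulf_neq0.
    by apply: contra_neq s0n => z1; rewrite -zs z1 expr0n mulr0.
  have s0E : 4 - 27 * s0 = - (3 * z - 1) * (3 * z - 4) * (3 * z - 1).
    rewrite -zs; ring.
  by apply: contra_neq s04 => z1; rewrite s0E z1 mulr0.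
exists (fun s => \row_k r k s); apply: filterS rP => s [dr rr rinj _]; split.
- by apply: differentiable_mx => i j; under eq_fun do rewrite mxE; exact: dr.
- by move=> i j; rewrite !mxE; exact: rinj.
- move=> k; rewrite !mxE; apply/eqP; rewrite -subr_eq0 -horner_cubic.
  exact: rr.
Unshelve. all: by end_near.
Qed.

Lemma near_neq (a b : K) : b != a -> \forall c \near b, c != a.
Proof.
rewrite -subr_eq0 => ba.
have c : {for b, continuous (fun c => c - a)}.
  by apply: differentiable_continuous; apply: differentiable_addr.
by apply: filterS (cvgr_neq0 _ c ba) => x; rewrite subr_eq0.
Qed.

(** Branches are composed: [s] as a function of [b], then an ordered triple of roots as a function
    of [s], the ordering being chosen separately near each of the four values [sg i b0]. *)
Lemma lam_branches (b0 : K) : b0 != 0 -> b0 != 1728 ->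
  exists lam : 'I_4 -> K -> 'rV[K]_3, \forall b \near b0,
    [/\ forall i, differentiable (lam i) b,
        forall i, injective (lam i b 0),
        forall i, [/\ esym1 (lam i b) = 2, esym2 (lam i b) = 1,
          esym3 (lam i b) != 0
          & numj (esym3 (lam i b)) = b * denj (esym3 (lam i b))],
        injective (fun i => esym3 (lam i b))
      & forall s, numj s = b * denj s -> exists i, s = esym3 (lam i b)].
Proof.
move=> b0n b0n'; have [||sg sgP] := @simple_branches numj_poly denj_poly 4 b0.
- have := near_neq b0n.
  by apply: filterS => b; exact: size_j_equation.
- move=> z; rewrite rootE hornerD hornerN hornerZ horner_numj horner_denj subr_eq0.
  move=> /eqP/(j_equation_simple b0n b0n')[_ _].
  suff [-> ->] : numj_poly^`().[z] = - (4608 * (1 - 6 * z) ^+ 2) /\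
      denj_poly^`().[z] = 12 * z ^+ 2 - 108 * z ^+ 3 by [].
  by split; rewrite /numj_poly /denj_poly !(derivM, derivB, derivX, derivC)
    !(hornerM, hornerD, hornerN, hornerX, hornerC); ring.
have rootE4 b s : root (numj_poly - b *: denj_poly) s <-> numj s = b * denj s.
  rewrite rootE hornerD hornerN hornerZ horner_numj horner_denj subr_eq0.
  by split=> /eqP.
have [dsg0 rsg0 _ _] := nbhs_singleton sgP.
have /choice[r rP] : forall i, exists r : K -> 'rV[K]_3, \forall s \near sg i b0,
    [/\ differentiable r s, injective (r s 0)
      & forall k, r s 0 k * (r s 0 k - 1) ^+ 2 = s].
  move=> i; have /rootE4 E := rsg0 i.
  by have [s0 s4 _] := j_equation_simple b0n b0n' E; exact: cubic_branches.
exists (fun i b => r i (sg i b)).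
have rsP : \forall b \near b0, forall i,
    [/\ differentiable (r i) (sg i b), injective (r i (sg i b) 0)
      & forall k, r i (sg i b) 0 k * (r i (sg i b) 0 k - 1) ^+ 2 = sg i b].
  apply: (@filter_forall _ _ (fun i b =>
    [/\ differentiable (r i) (sg i b), injective (r i (sg i b) 0)
      & forall k, r i (sg i b) 0 k * (r i (sg i b) 0 k - 1) ^+ 2 = sg i b])
    _ (nbhs_filter b0)) => i.
  exact: (differentiable_continuous (dsg0 i) (rP i)).
have bn : \forall b \near b0, b != 0 /\ b != 1728.
  by near=> b; split; near: b; exact: near_neq.
apply: filterS3 sgP rsP bn => b [dsg rsg isg asg] rb [bn0 bn1].
have es i : [/\ esym1 (r i (sg i b)) = 2, esym2 (r i (sg i b)) = 1
    & esym3 (r i (sg i b)) = sg i b].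
  by have [_ inj h] := rb i; exact: cubic_esym.
split.
- by move=> i; have [dr _ _] := rb i; exact: (differentiable_comp (dsg i) dr).
- by move=> i; have [] := rb i.
- move=> i; have [-> -> ->] := es i; have /rootE4 E := rsg i.
  by have [] := j_equation_simple bn0 bn1 E.
- move=> i j; have [_ _ ->] := es i; have [_ _ ->] := es j; exact: isg.
- move=> s /rootE4/asg[i ->]; exists i; by have [_ _ ->] := es i.
Unshelve. all: by end_near.
Qed.

End Branches.

(** * Taylor expansion of a square root *)

Lemma is_derive_horner (K : numFieldType) (p : {poly K}) (t : K) :
  is_derive t (1 : K) (fun x => p.[x]) (p^`().[t]).
Proof.
elim/poly_ind: p => [|p c IH].
  rewrite derivC horner0; under eq_fun do rewrite horner0.
  exact: is_derive_cst.
under eq_fun do rewrite hornerMXaddC.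
rewrite derivMXaddC hornerD hornerMX.
have h := is_deriveD (is_deriveM IH (is_derive_id t 1)) (is_derive_cst c t 1).
apply: (is_derive_eq h); rewrite /GRing.scale /= ; ring.
Qed.

Section SqrtTaylor.
Variable K : numClosedFieldType.
Implicit Types (P : {poly K}) (s : K -> K).

Lemma sqrt_branch P : P.[0] != 0 -> exists s : K -> K,
  \forall t \near (0 : K), derivable s t 1 /\ s t ^+ 2 = P.[t].
Proof.
move=> P0; have [q qP] := sqrt_local P0; exists (fun t => q P.[t]).
have c : {for (0 : K), continuous (horner P)}.
  by apply: differentiable_continuous; exact: differentiable_horner.
have nq : \forall t \near (0 : K), differentiable q P.[t] /\ q P.[t] ^+ 2 = P.[t].
  exact: (c _ qP).
near=> t.
have [dq qE] : differentiable q P.[t] /\ q P.[t] ^+ 2 = P.[t] by near: t.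
split=> //; apply/derivable1_diffP.
apply: (@differentiable_comp _ _ _ _ (horner P) q) => //.
exact: differentiable_horner.
Unshelve. all: by end_near.
Qed.

(** Differentiating [s^2 = P] twice gives [s'' = P'' / (2 s) - P'^2 / (4 s^3)], so the coefficient
    is [(4 P_0 P_2 - P_1^2) / (8 s(0)^3)], and its vanishing does not depend on the branch. *)
Lemma taylor_sqrt P s : P.[0] != 0 ->
  (\forall t \near (0 : K), derivable s t 1 /\ s t ^+ 2 = P.[t]) ->
  derive1n 2 s 0 / 2`!%:R = 0 <-> P`_1 ^+ 2 = 4 * P`_0 * P`_2.
Proof.
move=> P0 sP.
have s0 : s 0 != 0.
  by have [_ E] := nbhs_singleton sP; move: P0; rewrite -E expf_eq0.
have nearP0 : \forall t \near (0 : K), P.[t] != 0.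
  have c : {for (0 : K), continuous (horner P)}.
    by apply: differentiable_continuous; exact: differentiable_horner.
  exact: (cvgr_neq0 _ c P0).
(* The equation must hold on a neighbourhood of every nearby [t], in order to be differentiated
   there. *)
have sPj : \forall t \near (0 : K), \forall u \near t, s u * s u = P.[u].
  have sP2 : \forall t \near (0 : K), s t * s t = P.[t].
    by near=> t; rewrite -expr2; have [] : derivable s t 1 /\ s t ^+ 2 = P.[t] by near: t.
  exact: (near_join sP2).
have s1 : \forall t \near (0 : K), derive1 s t = P^`().[t] / (2 * s t).
  near=> t.
  have [dst sE] : derivable s t 1 /\ s t ^+ 2 = P.[t] by near: t.
  have Pt0 : P.[t] != 0 by near: t.
  have st0 : s t != 0 by move: Pt0; rewrite -sE expf_eq0.
  have nt : \forall u \near t, s u * s u = P.[u] by near: t.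
  have nt' : \forall u \near t, P.[u] = (s * s) u.
    by apply: filterS nt => u <-.
  have d1 := near_eq_is_derive nt' (is_derive_horner P t).
  have d2 := is_deriveM (derivableP dst) (derivableP dst).
  have := @derive_val _ _ _ _ _ _ _ d1; rewrite (@derive_val _ _ _ _ _ _ _ d2).
  rewrite derive1E /GRing.scale /= => <-; field.
  by rewrite ?st0 ?pnatr_eq0.
have d0 : derivable s 0 1 by have [] := nbhs_singleton sP.
have E0 : s 0 ^+ 2 = P.[0] by have [] := nbhs_singleton sP.
have s2 : derive1n 2 s 0 = P^`()^`().[0] / (2 * s 0) - P^`().[0] ^+ 2 / (4 * s 0 ^+ 3).
  rewrite derive1nS derive1n1 derive1E.
  have -> : 'D_1 (derive1 s) 0 = 'D_1 (fun t => P^`().[t] * (2 * s t)^-1) 0.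
    exact: near_eq_derive s1.
  have s20 : 2 * s 0 != 0 by rewrite mulf_neq0 // pnatr_eq0.
  have ds0 : is_derive (0 : K) (1 : K) s (P^`().[0] / (2 * s 0)).
    by rewrite -(nbhs_singleton s1) derive1E; exact: derivableP.
  have d1 := is_deriveM (@is_derive_cst _ _ _ (2 : K) (0 : K) (1 : K)) ds0.
  have s20' : (cst (2 : K) * s) 0 != 0 by exact: s20.
  have [d1d d1v] := d1.
  have d2 := DeriveDef (derivableV s20' d1d) (deriveV s20' d1d).
  rewrite d1v in d2.
  have d3 := is_deriveM (is_derive_horner P^`() 0) d2.
  rewrite (@derive_val _ _ _ _ _ _ _ d3) /GRing.scale /= (_ : (cst 2 * s) 0 = 2 * s 0) //; field.
  by rewrite ?s0 ?pnatr_eq0.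
rewrite s2.
have -> : P^`()^`().[0] = 2 * P`_2.
  by rewrite horner_coef0 !coef_deriv mulr1n mulr_natl.
have -> : P^`().[0] = P`_1 by rewrite horner_coef0 coef_deriv.
rewrite -horner_coef0 -E0.
have f2 : (2`!%:R : K) != 0 by rewrite pnatr_eq0.
have E : (2 * P`_2 / (2 * s 0) - P`_1 ^+ 2 / (4 * s 0 ^+ 3)) / 2`!%:R =
    (4 * s 0 ^+ 2 * P`_2 - P`_1 ^+ 2) / (8 * s 0 ^+ 3).
  by rewrite (_ : 2`! = 2%N) //; field; rewrite ?s0 ?pnatr_eq0.
rewrite E; split=> [/eqP|->].
  rewrite mulf_eq0 invr_eq0 mulf_eq0 pnatr_eq0 expf_eq0 (negPf s0) !orbF subr_eq0.
  by move=> /eqP.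
by rewrite subrr mul0r.
Unshelve. all: by end_near.
Qed.

End SqrtTaylor.

(** * Pairs of conics over a closed field *)

(* The notions of [Defs] over an arbitrary closed field: at [R[i]] they are
   convertible to the original ones. *)
Section ClosedFieldConics.
Variable K : numClosedFieldType.

Definition kmx3 : Type := pspace K 2 2.
Definition ckmx3 : cspace K := cproj K 2 2.
Definition kpairs : cspace K := cprod ckmx3 ckmx3.

Definition ktransverse : set kpairs :=
  [set p | [/\ (prep p.1)^T = prep p.1 /\ (prep p.2)^T = prep p.2,
               \det (prep p.1) != 0 /\ \det (prep p.2) != 0
             & (inter (prep p.1) (prep p.2) #= `I_4)%card]].

Definition ksqrt_branch (p : kpairs) (s : K -> K) : Prop :=
  \forall t \near (0 : K), derivable s t 1 /\
    s t ^+ 2 = \det (t *: prep p.1 + prep p.2).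

Definition kcayley : set kpairs :=
  [set p | ktransverse p /\
     exists2 s, ksqrt_branch p s & derive1n 2 s 0 / 2`!%:R = 0].

Definition kj_weierstrass (a b c : K) : K :=
  - (256 * (a ^+ 2 - 3 * b) ^+ 3
     / (4 * a ^+ 3 * c - a ^+ 2 * b ^+ 2 - 18 * a * b * c
        + 4 * b ^+ 3 + 27 * c ^+ 2)).

Definition kj_inv (p : kpairs) : K :=
  let s := pencil (prep p.1) (prep p.2) in
  kj_weierstrass (s`_2 / s`_3) (s`_1 / s`_3) (s`_0 / s`_3).

Definition kPGL3 : set ckmx3 := [set g | \det (prep g) != 0].

Definition kcongr_act (g : kmx3) (p : kpairs) : kpairs :=
  (pclass ((prep g)^T *m prep p.1 *m prep g),
   pclass ((prep g)^T *m prep p.2 *m prep g)).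

Definition korbit (p : kpairs) : set kpairs :=
  [set kcongr_act g p | g in kPGL3].

Definition kj_bar (o : set (kmx3 * kmx3)) : K :=
  kj_inv (xget (pclass 1%:M, pclass 1%:M) o).

Definition kspecial_moduli : set (set kpairs) :=
  [set o | (korbit @` kcayley) o /\ (kj_bar o = 0 \/ kj_bar o = 1728)].

Definition kspecial : set kpairs :=
  [set p | kcayley p /\ (kj_inv p = 0 \/ kj_inv p = 1728)].

Definition kV4 : set kmx3 :=
  [set pclass (diag_mx a) | a in
     [set a : 'rV[K]_3 | forall i, a 0 i = 1 \/ a 0 i = -1]].

Definition kcoset (g : kmx3) : set kmx3 :=
  [set pclass (prep g *m prep a) | a in kV4].

Definition ckG_V4 : cspace K := cquot (kcoset : ckmx3 -> _).
Definition kG_V4 : set ckG_V4 := kcoset @` kPGL3.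
Definition kfour_G_V4 : set (ccopies 4 ckG_V4) := [set: 'I_4] `*` kG_V4.
Definition kj_base : set K := [set z | z != 0 /\ z != 1728].

End ClosedFieldConics.

Arguments ktransverse K : clear implicits.
Arguments kcayley K : clear implicits.
Arguments kj_inv K : clear implicits.
Arguments kPGL3 K : clear implicits.
Arguments korbit K : clear implicits.
Arguments kspecial_moduli K : clear implicits.
Arguments kspecial K : clear implicits.
Arguments kV4 K : clear implicits.
Arguments kG_V4 K : clear implicits.
Arguments kfour_G_V4 K : clear implicits.
Arguments kj_base K : clear implicits.


(** * Normal forms of pairs of conics *)

Section NormalForm.
Variable C : numClosedFieldType.
Implicit Types (p : kpairs C) (g h : 'M[C]_3) (l : 'rV[C]_3).

Definition nf g l : kpairs C := (pclass (diag_form g l), pclass (g *m g^T)).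

Lemma unit_mx_neq0 n (A : 'M[C]_n.+1) : A \in unitmx -> A != 0.
Proof.
by rewrite unitmxE unitfE; apply: contraNneq => ->; rewrite det0.
Qed.

Lemma gram_unit g : g \in unitmx -> g *m g^T \in unitmx.
Proof. by move=> gu; rewrite unitmx_mul gu unitmx_tr. Qed.

Lemma diag_form_unit g l : g \in unitmx -> (forall k, l 0 k != 0) ->
  diag_form g l \in unitmx.
Proof.
move=> gu ln; rewrite unitmxE det_diag_form unitfE mulf_neq0 ?expf_neq0 //.
  by rewrite -unitfE -unitmxE.
by apply/prodf_neq0 => k _; exact: ln.
Qed.

Lemma prep_nf g l : g \in unitmx -> (forall k, l 0 k != 0) ->
  exists c d : C, [/\ c != 0, d != 0, prep (nf g l).1 = c *: diag_form g l
    & prep (nf g l).2 = d *: (g *m g^T)].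
Proof.
move=> gu ln.
have [c c0 cE] := prep_pclass (unit_mx_neq0 (diag_form_unit gu ln)).
have [d d0 dE] := prep_pclass (unit_mx_neq0 (gram_unit gu)).
by exists c, d.
Qed.

Lemma nfZ g l c : c != 0 -> nf g (c *: l) = nf g l.
Proof. by move=> c0; rewrite /nf diag_formZ pclassZ. Qed.

Lemma nfZl g l c : c != 0 -> nf (c *: g) l = nf g l.
Proof.
move=> c0; rewrite /nf diag_formZl linearZ /= -scalemxAl -scalemxAr scalerA.
by rewrite !pclassZ // ?mulf_neq0.
Qed.

Lemma transverse_nf p : ktransverse C p <->
  exists g l, [/\ g \in unitmx, injective (l 0), forall k, l 0 k != 0 & p = nf g l].
Proof.
split.
  move=> [[T1 T2] [N1 N2] I4].
  have [g [l [gu linj ln E1 E2]]] := inter_card_diag T1 T2 N1 N2 I4.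
  exists g, l; split=> //; rewrite /nf -E1 -E2 !prepK.
  by case: (p).
move=> [g [l [gu linj ln ->]]].
have [c [d [c0 d0 E1 E2]]] := prep_nf gu ln.
(* The scalars of the representatives are absorbed: [d] into [g] through its square root, then
   [c / d] into [l]. *)
have Su := sqrtC_eq0 d.
have E2' : prep (nf g l).2 = (sqrtC d *: g) *m (sqrtC d *: g)^T.
  by rewrite -diag_form1 diag_formZl diag_form1 sqrtCK.
have E1' : prep (nf g l).1 = diag_form (sqrtC d *: g) ((c / d) *: l).
  by rewrite diag_formZl sqrtCK diag_formZ scalerA mulrC divfK.
have su : sqrtC d *: g \in unitmx.
  by rewrite unitmxE detZ unitrM -unitmxE gu andbT unitfE expf_neq0 // sqrtC_eq0.
have cd0 : c / d != 0 by rewrite mulf_neq0 // invr_eq0.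
have ln' k : ((c / d) *: l) 0 k != 0 by rewrite mxE mulf_neq0.
split.
- by rewrite E1' E2' diag_form_sym trmx_mul trmxK.
- rewrite E1' E2' -!unitfE -!unitmxE.
  by split; [exact: diag_form_unit|exact: gram_unit].
- have := @inter_diag_card _ _ ((c / d) *: l) su.
  rewrite -E1' -E2'; apply.
  by move=> i j; rewrite !mxE => /(mulfI cd0)/linj.
Qed.

(** The coefficients have weights 1, 2, 3, while the numerator and the discriminant both have weight
    6. With [k = d / c] this is the effect of changing the representatives of the two conics. *)
Lemma kj_weierstrassZ (k a b c : C) : k != 0 ->
  kj_weierstrass (k * a) (k ^+ 2 * b) (k ^+ 3 * c) = kj_weierstrass a b c.
Proof.
move=> k0; rewrite /kj_weierstrass; congr (- _).
rewrite (_ : 256 * _ ^+ 3 = k ^+ 6 * (256 * (a ^+ 2 - 3 * b) ^+ 3)); last by ring.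
rewrite (_ : _ + 27 * _ ^+ 2 = k ^+ 6 * (4 * a ^+ 3 * c - a ^+ 2 * b ^+ 2
  - 18 * a * b * c + 4 * b ^+ 3 + 27 * c ^+ 2)); last by ring.
by rewrite -mulf_div divff ?mul1r // expf_neq0.
Qed.

Lemma j_inv_nf g l : g \in unitmx -> (forall k, l 0 k != 0) ->
  kj_inv C (nf g l) =
  kj_weierstrass (esym2 l / esym3 l) (esym1 l / esym3 l) (esym3 l)^-1.
Proof.
move=> gu ln; have [c [d [c0 d0 E1 E2]]] := prep_nf gu ln.
have [s0 s1 s2 s3] := pencil_coef g l c d.
rewrite /kj_inv E1 E2 s0 s1 s2 s3.
have dg : \det g != 0 by rewrite -unitfE -unitmxE.
have l3 : esym3 l != 0 by rewrite !mulf_neq0.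
have cd0 : d / c != 0 by rewrite mulf_neq0 // invr_eq0.
rewrite -[RHS](kj_weierstrassZ _ _ _ cd0); congr kj_weierstrass; field;
 by rewrite ?dg ?c0 ?l3.
Qed.

Lemma sqrt_cond_nf g l : g \in unitmx -> (forall k, l 0 k != 0) ->
  (exists2 s, ksqrt_branch (nf g l) s & derive1n 2 s 0 / 2`!%:R = 0) <->
  esym1 l ^+ 2 = 4 * esym2 l.
Proof.
move=> gu ln; have [c [d [c0 d0 E1 E2]]] := prep_nf gu ln.
have [s0 s1 s2 s3] := pencil_coef g l c d.
have dg : \det g != 0 by rewrite -unitfE -unitmxE.
set P := pencil _ _ in s0 s1 s2 s3.
have P0 : P.[0] != 0 by rewrite horner_coef0 s0 mulf_neq0 ?expf_neq0.
have brE s : ksqrt_branch (nf g l) s <->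
    \forall t \near (0 : C), derivable s t 1 /\ s t ^+ 2 = P.[t].
  rewrite /ksqrt_branch E1 E2.
  by split; apply: filterS => t [dt ->]; split=> //; rewrite horner_pencil.
have PE : P`_1 ^+ 2 = 4 * P`_0 * P`_2 <-> esym1 l ^+ 2 = 4 * esym2 l.
  have k0 : \det g ^+ 4 * d ^+ 4 * c ^+ 2 != 0 by rewrite !mulf_neq0 ?expf_neq0.
  rewrite s0 s1 s2; split=> [h|h].
    by apply: (mulfI k0); transitivity ((\det g ^+ 2 * (d ^+ 2 * c * esym1 l)) ^+ 2);
      [ring|rewrite h; ring].
  transitivity (\det g ^+ 4 * d ^+ 4 * c ^+ 2 * (esym1 l ^+ 2)); first ring.
  by rewrite h; ring.
split=> [[s /brE bs ts]|h].
  by apply/PE; apply/(taylor_sqrt P0 bs).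
have [s sP] := sqrt_branch P0.
exists s; first exact/brE.
by apply/(taylor_sqrt P0 sP)/PE.
Qed.

Lemma congr_act_nf (h : kmx3 C) g l : kPGL3 C h -> g \in unitmx ->
  (forall k, l 0 k != 0) -> kcongr_act h (nf g l) = nf ((prep h)^T *m g) l.
Proof.
move=> hu gu ln; have [c [d [c0 d0 E1 E2]]] := prep_nf gu ln.
rewrite /kcongr_act E1 E2 /nf -!scalemxAr -!scalemxAl !pclassZ //.
congr (pclass _, pclass _); first by rewrite diag_formM trmxK.
by rewrite trmx_mul trmxK !mulmxA.
Qed.

Lemma cayley_nf p : kcayley C p <->
  exists g l, [/\ g \in unitmx, injective (l 0), forall k, l 0 k != 0,
     esym1 l ^+ 2 = 4 * esym2 l & p = nf g l].
Proof.
split=> [[/transverse_nf[g [l [gu linj ln ->]]]]|[g [l [gu linj ln le ->]]]].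
  by move=> /(sqrt_cond_nf gu ln) h; exists g, l.
by split; [apply/transverse_nf; exists g, l|apply/(sqrt_cond_nf gu ln)].
Qed.

End NormalForm.

(** * Orbits and normalized eigenvalues *)

Section Orbits.
Variable K : numClosedFieldType.
Implicit Types (p q : kpairs K) (g h : 'M[K]_3) (l : 'rV[K]_3) (b : K).

Lemma korbit_refl p : ktransverse K p -> korbit K p p.
Proof.
move=> /transverse_nf[g [l [gu linj ln ->]]].
have n1 : (1%:M : 'M[K]_3) != 0 by exact: oner_neq0.
have [c c0 cE] := prep_pclass n1.
have c1 : kPGL3 K (pclass 1%:M).
  by rewrite /kPGL3 /= cE detZ det1 mulr1 expf_neq0.
exists (pclass 1%:M) => //.
rewrite congr_act_nf // cE linearZ /= trmx1 -scalemxAl mul1mx.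
exact: nfZl.
Qed.

Lemma korbit_nf q g l : g \in unitmx -> (forall k, l 0 k != 0) ->
  korbit K (nf g l) q -> exists2 g', g' \in unitmx & q = nf g' l.
Proof.
move=> gu ln [h hu <-]; exists ((prep h)^T *m g); last exact: congr_act_nf.
by rewrite unitmx_mul gu andbT unitmx_tr unitmxE unitfE.
Qed.

(** Congruence changes [g] and keeps [l], while [j] and the Cayley condition depend on [l] only;
    hence any representative picked by [kj_bar] gives the same value. *)
Lemma kspecialE : kspecial K = ktransverse K `&` korbit K @^-1` kspecial_moduli K.
Proof.
have jb g l : g \in unitmx -> injective (l 0) -> (forall k, l 0 k != 0) ->
    kj_bar (korbit K (nf g l)) = kj_inv K (nf g l).
  move=> gu linj ln; rewrite /kj_bar; set q := xget _ _.
  have qo : korbit K (nf g l) q.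
    apply: xgetPex; exists (nf g l); apply: korbit_refl; apply/transverse_nf.
    by exists g, l.
  have [g' g'u ->] := korbit_nf gu ln qo.
  by rewrite !j_inv_nf.
apply/seteqP; split=> p.
  move=> [cp jp]; have [tp _] := cp.
  split; first exact: tp.
  split; first by exists p.
  have [g [l [gu linj ln pE]]] := (transverse_nf p).1 tp.
  by rewrite pE jb // -pE.
move=> [tp [[q cq qp] jp]]; have [tq _] := cq.
have [g [l [gu linj ln pE]]] := (transverse_nf p).1 tp.
split; last by move: jp; rewrite pE jb.
have [gq [lq [gqu lqinj lqn lqe qE]]] := (cayley_nf q).1 cq.
(* [p] lies in its own orbit, which is that of the Cayley pair [q], so it has a normal form with the
   eigenvalues of [q]. *)
have : korbit K q p by rewrite qp; exact: korbit_refl.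
rewrite qE => /(korbit_nf gqu lqn)[g' g'u p'E].
by apply/cayley_nf; exists g', lq.
Qed.

Definition ordinary : set (kpairs K) := kcayley K `\` kspecial K.

Definition normalized l : Prop :=
  [/\ injective (l 0), esym1 l = 2, esym2 l = 1 & esym3 l != 0].

Lemma normalized_neq0 l : normalized l -> forall k, l 0 k != 0.
Proof.
move=> [_ _ _]; rewrite /esym3 !mulf_eq0 !negb_or => /andP[/andP[l0 l1] l2].
exact: forall_ord3.
Qed.

(** The squared product of the differences of the eigenvalues is [e_3 (4 - 27 e_3)]. *)
Lemma normalized_disc l : normalized l -> 4 - 27 * esym3 l != 0.
Proof.
move=> [linj l1 l2 _].
have n i j : i != j -> l 0 i - l 0 j != 0.
  by rewrite subr_eq0; apply: contra => /eqP/linj ->.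
have d : esym3 l * (4 - 27 * esym3 l) =
    ((l 0 0 - l 0 1) * (l 0 0 - l 0 2) * (l 0 1 - l 0 2)) ^+ 2.
  transitivity (esym1 l ^+ 2 * esym2 l ^+ 2 - 4 * esym2 l ^+ 3
    - 4 * esym1 l ^+ 3 * esym3 l + 18 * esym1 l * esym2 l * esym3 l
    - 27 * esym3 l ^+ 2); first by rewrite l1 l2; ring.
  by rewrite /esym1 /esym2 /esym3; ring.
have : esym3 l * (4 - 27 * esym3 l) != 0.
  by rewrite d expf_neq0 // !mulf_neq0 // n.
by rewrite mulf_eq0 negb_or => /andP[].
Qed.

Lemma j_inv_normalized g l : g \in unitmx -> normalized l ->
  numj (esym3 l) = kj_inv K (nf g l) * denj (esym3 l).
Proof.
move=> gu nl; have d := normalized_disc nl; have ln := normalized_neq0 nl.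
have [linj l1 l2 l3] := nl; rewrite j_inv_nf // l1 l2.
rewrite /kj_weierstrass /numj /denj.
move: (esym3 l) l3 d => s s0 s4.
have -> : 4 * (1 / s) ^+ 3 * s^-1 - (1 / s) ^+ 2 * (2 / s) ^+ 2
    - 18 * (1 / s) * (2 / s) * s^-1 + 4 * (2 / s) ^+ 3 + 27 * s^-1 ^+ 2
    = - (4 - 27 * s) / s ^+ 3 by field.
by field; rewrite s0 ?oppr_eq0 s4.
Qed.

Lemma esym1Z (c : K) l : esym1 (c *: l) = c * esym1 l.
Proof. by rewrite /esym1 !mxE; ring. Qed.

Lemma esym2Z (c : K) l : esym2 (c *: l) = c ^+ 2 * esym2 l.
Proof. by rewrite /esym2 !mxE; ring. Qed.

Lemma esym3Z (c : K) l : esym3 (c *: l) = c ^+ 3 * esym3 l.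
Proof. by rewrite /esym3 !mxE; ring. Qed.

Lemma ordinary_nf p : ordinary p <->
  exists g l, [/\ g \in unitmx, normalized l, kj_base K (kj_inv K p) & p = nf g l].
Proof.
split=> [[cp sp]|[g [l [gu nl [j0 j1] pE]]]]; last first.
  split; last by move=> [_ []] /eqP; [rewrite (negPf j0)|rewrite (negPf j1)].
  have [linj l1 l2 l3] := nl.
  apply/cayley_nf; exists g, l; split=> //; first exact: normalized_neq0.
  by rewrite l1 l2 mulr1 expr2 -natrM.
have [g [l [gu linj ln le pE]]] := (cayley_nf p).1 cp.
have jb : kj_base K (kj_inv K p).
  by split; apply/negP => /eqP jp; apply: sp; split => //; [left|right].
have e1 : esym1 l != 0.
  have [+ _] := jb; apply: contraNneq => e1.
  have e2 : esym2 l = 0.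
    apply: (@mulfI _ 4); first by rewrite pnatr_eq0.
    by rewrite mulr0 -le e1 expr0n.
  rewrite pE j_inv_nf // e1 e2 !mul0r /kj_weierstrass expr0n /= mulr0 subrr.
  by rewrite expr0n /= mulr0 mul0r oppr0.
have c0 : 2 / esym1 l != 0 by rewrite mulf_neq0 ?invr_eq0 // pnatr_eq0.
exists g, ((2 / esym1 l) *: l); split=> //; last by rewrite nfZ.
split.
- by move=> i j; rewrite !mxE => /(mulfI c0)/linj.
- by rewrite esym1Z divfK.
- rewrite esym2Z; have -> : esym2 l = esym1 l ^+ 2 / 4 by rewrite le; field.
  by field.
- rewrite esym3Z; apply: mulf_neq0; first exact: expf_neq0.
  by rewrite /esym3 !mulf_neq0.
Qed.

Lemma nf_ordinary g l b : g \in unitmx -> normalized l -> kj_base K b ->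
  numj (esym3 l) = b * denj (esym3 l) ->
  ordinary (nf g l) /\ kj_inv K (nf g l) = b.
Proof.
move=> gu nl bb E; have [_ _ _ l3] := nl.
have jE : kj_inv K (nf g l) = b.
  have d0 : denj (esym3 l) != 0.
    by rewrite /denj mulf_neq0 ?expf_neq0 // normalized_disc.
  by apply: (mulIf d0); rewrite -E -(j_inv_normalized gu nl).
by split=> //; apply/ordinary_nf; exists g, l; rewrite jE.
Qed.

End Orbits.

(** * Stabilizers *)

Section Cosets.
Variable K : numClosedFieldType.
Implicit Types (g h : 'M[K]_3) (l a : 'rV[K]_3) (c d : K).

Definition signs a : Prop := forall k, a 0 k = 1 \/ a 0 k = -1.

Lemma signs_sqr a : signs a -> forall k, a 0 k ^+ 2 = 1.
Proof. by move=> s k; case: (s k) => ->; rewrite ?sqrrN expr1n. Qed.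

Lemma sqr_signs a : (forall k, a 0 k ^+ 2 = 1) -> signs a.
Proof.
move=> h k; have /eqP := h k; rewrite -[X in _ == X](expr1n _ 2) eqf_sqr.
by move=> /orP[] /eqP ->; [left|right].
Qed.

Lemma diag_signs a : signs a -> diag_mx a *m diag_mx a = 1%:M.
Proof.
move=> /signs_sqr s; apply/matrixP => i j; rewrite mul_diag_mx !mxE.
by case: eqVneq => [->|]; rewrite ?mulr1n ?mulr0n ?mulr0 // -expr2 s.
Qed.

Lemma diag_signs_unit a : signs a -> diag_mx a \in unitmx.
Proof. by move=> /diag_signs /mulmx1_unit[]. Qed.

Lemma signsM a b : signs a -> signs b -> signs (\row_k (a 0 k * b 0 k)).
Proof.
move=> /signs_sqr sa /signs_sqr sb; apply: sqr_signs => k.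
by rewrite mxE exprMn sa sb mulr1.
Qed.

Lemma nf_signs g l a : signs a -> nf (g *m diag_mx a) l = nf g l.
Proof.
move=> /signs_sqr s; rewrite /nf -[g *m _ *m _]diag_form1 !diag_form_scale_col.
have E l' : \row_k (a 0 k ^+ 2 * l' 0 k) = l' :> 'rV[K]_3.
  by apply/rowP => k; rewrite mxE s mul1r.
by rewrite !E diag_form1.
Qed.

Lemma kcosetP g x : g \in unitmx ->
  kcoset (pclass g) x <-> exists2 a, signs a & x = pclass (g *m diag_mx a).
Proof.
move=> gu; have [c c0 cE] := prep_pclass (unit_mx_neq0 gu).
have E a : signs a ->
    pclass (prep (pclass g) *m prep (pclass (diag_mx a))) = pclass (g *m diag_mx a).
  move=> sa; have [d d0 dE] := prep_pclass (unit_mx_neq0 (diag_signs_unit sa)).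
  by rewrite cE dE -scalemxAl -scalemxAr scalerA pclassZ // mulf_neq0.
split; first by move=> [_ [a sa <-] <-]; exists a => //; rewrite E.
by move=> [a sa ->]; exists (pclass (diag_mx a)); [exists a|rewrite E].
Qed.

Lemma kcoset_eq g g' : g \in unitmx -> g' \in unitmx ->
  kcoset (pclass g) = kcoset (pclass g') <->
  exists2 c, c != 0 & exists2 a, signs a & g' = c *: (g *m diag_mx a).
Proof.
move=> gu gu'; split.
  move=> E; have : kcoset (pclass g') (pclass g').
    apply/(kcosetP _ gu'); exists (const_mx 1); first by move=> k; left; rewrite mxE.
    by rewrite diag_const_mx mulmx1.
  rewrite -E => /(kcosetP _ gu)[a sa] /esym/pclassP[].
  - by apply: unit_mx_neq0; rewrite unitmx_mul gu diag_signs_unit.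
  - exact: unit_mx_neq0.
  - by move=> c c0 ->; exists c => //; exists a.
move=> [c c0 [a sa ->]].
have gau : g *m diag_mx a \in unitmx by rewrite unitmx_mul gu diag_signs_unit.
rewrite pclassZ //; apply/seteqP; split=> x.
  move=> /(kcosetP _ gu)[b sb ->]; apply/(kcosetP _ gau).
  exists (\row_k (a 0 k * b 0 k)); first exact: signsM.
  congr pclass; rewrite -mulmxA; congr (_ *m _).
  apply/matrixP => i j; rewrite mul_diag_mx !mxE.
  by case: eqVneq => [->|]; rewrite ?mulr1n ?mulr0n ?mulr0 // mulrA -expr2 (signs_sqr sa) mul1r.
move=> /(kcosetP _ gau)[b sb ->]; apply/(kcosetP _ gu).
exists (\row_k (a 0 k * b 0 k)); first exact: signsM.
congr pclass; rewrite -mulmxA; congr (_ *m _).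
apply/matrixP => i j; rewrite mul_diag_mx !mxE.
by case: eqVneq => [->|]; rewrite ?mulr1n ?mulr0n ?mulr0.
Qed.

Lemma kG_V4P x : kG_V4 K x <-> exists2 g, g \in unitmx & x = kcoset (pclass g).
Proof.
split=> [[h hu <-]|[g gu ->]].
  by exists (prep h); rewrite ?prepK // unitmxE unitfE.
exists (pclass g) => //.
have [c c0 cE] := prep_pclass (unit_mx_neq0 gu).
by rewrite /kPGL3 /= cE detZ mulf_neq0 ?expf_neq0 // -unitfE -unitmxE.
Qed.

(** The parametrization of [ckG_V4] runs over all non-zero matrices, singular ones included. A coset
    contains the class of its representative, as [V_4] contains the identity, so invertibility can
    be read off from the coset as a set. *)
Lemma kG_V4_unit g : g != 0 -> kG_V4 K (kcoset (pclass g)) -> g \in unitmx.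
Proof.
move=> g0 /kG_V4P[h hu E]; have [c c0 cE] := prep_pclass g0.
have : kcoset (pclass g) (pclass (prep (pclass g) *m 1%:M)).
  have n1 : (1%:M : 'M[K]_3) != 0 by exact: oner_neq0.
  have [d d0 dE] := prep_pclass n1.
  exists (pclass 1%:M); last by rewrite dE -scalemxAr pclassZ.
  exists (const_mx 1); last by rewrite diag_const_mx.
  by move=> k; left; rewrite mxE.
rewrite mulmx1 prepK E => /(kcosetP _ hu)[a sa] /esym.
have hau : h *m diag_mx a \in unitmx by rewrite unitmx_mul hu diag_signs_unit.
move=> /pclassP[]; rewrite ?(unit_mx_neq0 hau) // => e e0 ->.
rewrite unitmxE detZ unitrM -unitmxE hau andbT unitfE; exact: expf_neq0.
Qed.

(** The two conics are rescaled independently, by [c] and [d]. Since [e_1 = 2] on both sides,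
    [diag_form_esym] forces [c = d], and then the values of [e_3] agree. *)
Lemma nf_eq g g' l l' : g \in unitmx -> g' \in unitmx ->
  normalized l -> normalized l' -> nf g l = nf g' l' ->
  esym3 l = esym3 l' /\ exists2 d, d != 0 &
    diag_form g' l' = d *: diag_form g l /\ g' *m g'^T = d *: (g *m g^T).
Proof.
move=> gu gu' nl nl' [/pclassP E1 /pclassP E2].
have [c c0 Ec] := E1 (unit_mx_neq0 (diag_form_unit gu (normalized_neq0 nl)))
  (unit_mx_neq0 (diag_form_unit gu' (normalized_neq0 nl'))).
have [d d0 Ed] := E2 (unit_mx_neq0 (gram_unit gu)) (unit_mx_neq0 (gram_unit gu')).
have [e1 e3] := diag_form_esym gu d0 Ec Ed.
have [_ l1 _ _] := nl; have [_ l1' _ _] := nl'.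
have cd : c = d.
  by apply: (@mulIf _ 2); [rewrite pnatr_eq0|rewrite -{1}l1 -l1'].
split; last by exists d => //; rewrite -{1}cd.
by apply: (mulfI (expf_neq0 3 d0)); rewrite e3 cd.
Qed.

(** Square roots of the same [d] differ by signs, so the scaling is the scalar [sqrtC d] times an
    element of [V_4]. *)
Lemma col_scaling_coset g a d : g \in unitmx -> d != 0 ->
  (forall k, a 0 k ^+ 2 = d) ->
  g *m diag_mx a \in unitmx /\ kcoset (pclass (g *m diag_mx a)) = kcoset (pclass g).
Proof.
move=> gu d0 ad; have s0 : sqrtC d != 0 by rewrite sqrtC_eq0.
have E : g *m diag_mx a = sqrtC d *: (g *m diag_mx ((sqrtC d)^-1 *: a)).
  by rewrite scalemxAr -linearZ /= scalerA divff // scale1r.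
have sa : signs ((sqrtC d)^-1 *: a).
  by apply: sqr_signs => k; rewrite mxE exprMn ad exprVn sqrtCK mulVf.
have gau : g *m diag_mx a \in unitmx.
  rewrite E unitmxE detZ unitrM -unitmxE unitmx_mul gu diag_signs_unit // andbT.
  by rewrite unitfE expf_neq0.
split=> //; apply/esym/(kcoset_eq gu gau); exists (sqrtC d) => //.
by exists ((sqrtC d)^-1 *: a).
Qed.

Lemma nf_coset g g' l : g \in unitmx -> g' \in unitmx -> normalized l ->
  nf g l = nf g' l -> kcoset (pclass g) = kcoset (pclass g').
Proof.
move=> gu gu' nl /(nf_eq gu gu' nl nl)[_ [d d0 [E1 E2]]].
have [linj _ _ _] := nl.
have [a ad ->] := diag_form_stab gu d0 linj E1 E2.
by have [_ ->] := col_scaling_coset gu d0 ad.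
Qed.

(** The three symmetric functions agree, so [l] and [l'] are the same roots in two orders; the
    permutation is passed on to the columns of [g]. *)
Lemma nf_perm g l l' : g \in unitmx -> normalized l -> normalized l' ->
  esym3 l = esym3 l' -> exists2 g', g' \in unitmx & nf g l = nf g' l'.
Proof.
move=> gu [linj l1 l2 _] [_ l1' l2' _] l3.
have root k : exists j, l 0 k = l' 0 j.
  have prodE (m : 'rV[K]_3) x : (x - m 0 0) * (x - m 0 1) * (x - m 0 2) =
      x ^+ 3 - esym1 m * x ^+ 2 + esym2 m * x - esym3 m.
    by rewrite /esym1 /esym2 /esym3; ring.
  have : (l 0 k - l' 0 0) * (l 0 k - l' 0 1) * (l 0 k - l' 0 2) = 0.
    rewrite prodE l1' l2' -l3 -{1}l1 -{1}l2 -prodE; apply/eqP.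
    by move: k; apply: forall_ord3; rewrite !mulf_eq0 subrr eqxx ?orbT.
  move/eqP; rewrite !mulf_eq0 !subr_eq0 => /orP[/orP[]|] /eqP ->;
    by [exists 0|exists 1|exists 2].
have [s sE] := choice root.
have sinj : injective s by move=> i j sij; apply: linj; rewrite !sE sij.
pose g' := col_perm (perm sinj)^-1 g.
have gE i k : g i k = g' i (s k).
  by rewrite mxE -[s k](permE sinj) permK.
exists g'; first by rewrite /g' col_permE unitmx_mul gu unitmx_perm.
have E (m m' : 'rV[K]_3) : (forall k, m 0 k = m' 0 (s k)) ->
    diag_form g m = diag_form g' m'.
  move=> mE; apply/matrixP => i j; rewrite !diag_formE [RHS](reindex_inj sinj).
  by apply: eq_bigr => k _; rewrite !gE mE.
rewrite /nf (E _ _ sE) -!diag_form1; congr (_, pclass _).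
by apply: E => k; rewrite !mxE.
Qed.

End Cosets.

(** * Local trivialization *)

Section JFunction.
Variable K : numClosedFieldType.
Notation model := ('M[K]_3 * 'M[K]_3)%type.
Implicit Types (v w : model).

Definition sig k w : K := (pencil w.1 w.2)`_k.
(** On diagonal forms the value is [8 e_3 / e_1^3], in which the scalings of both conics and [det g]
    cancel; when [e_1 = 2] it is [e_3]. Being rational in the entries, it extends [s], and [jfun]
    extends [j], to matrices off the Cayley set, as differentiability in the model requires. *)
Definition sfun w : K := 8 * sig 3 w * sig 0 w ^+ 2 / sig 1 w ^+ 3.
Definition jfun w : K := numj (sfun w) / denj (sfun w).

Definition kpar w : kpairs K := (pclass w.1, pclass w.2).

Lemma differentiable_sig k v : differentiable (sig k) v.
Proof.
exact: (differentiable_coef_pencil k (@differentiable_fst _ _ _ v) (@differentiable_snd _ _ _ v)).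
Qed.

Lemma differentiable_sfun v : sig 1 v != 0 -> differentiable sfun v.
Proof.
move=> s1; rewrite /sfun; apply: differentiable_mulr.
  apply: differentiable_mulr; last first.
    by rewrite /GRing.exp /=; apply: differentiable_mulr; exact: differentiable_sig.
  apply: differentiable_mulr; last exact: differentiable_sig.
  exact: differentiable_cst.
apply: differentiableV; last exact: expf_neq0.
by rewrite /GRing.exp /=; do 2?apply: differentiable_mulr; exact: differentiable_sig.
Qed.

Lemma differentiable_jfun v : sig 1 v != 0 -> denj (sfun v) != 0 ->
  differentiable jfun v.
Proof.
move=> s1 d0; have ds := differentiable_sfun s1; rewrite /jfun.
apply: differentiable_mulr.
  by under eq_fun do rewrite -horner_numj; exact: differentiable_horner.
apply: differentiableV => //.
by under eq_fun do rewrite -horner_denj; exact: differentiable_horner.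
Qed.

Lemma nf_model w : w.1 != 0 -> w.2 != 0 -> forall g l, g \in unitmx -> normalized l ->
  kpar w = nf g l -> exists c d, [/\ c != 0, d != 0,
    w.1 = c *: diag_form g l & w.2 = d *: (g *m g^T)].
Proof.
move=> w1 w2 g l gu nl [/esym/pclassP E1 /esym/pclassP E2].
have [c c0 Ec] := E1 (unit_mx_neq0 (diag_form_unit gu (normalized_neq0 nl))) w1.
have [d d0 Ed] := E2 (unit_mx_neq0 (gram_unit gu)) w2.
by exists c, d.
Qed.

Lemma sfun_model g l c d : g \in unitmx -> normalized l -> c != 0 -> d != 0 ->
  let w := (c *: diag_form g l, d *: (g *m g^T)) in
  sig 1 w != 0 /\ sfun w = esym3 l.
Proof.
move=> gu [linj l1 l2 l3] c0 d0 w; have [s0 s1 s2 s3] := pencil_coef g l c d.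
have dg : \det g != 0 by rewrite -unitfE -unitmxE.
rewrite /sfun /sig /= s0 s1 s3 l1; split; last by field; rewrite dg c0 d0.
by rewrite !mulf_neq0 ?expf_neq0 // pnatr_eq0.
Qed.

Lemma jfun_ordinary w : w.1 != 0 -> w.2 != 0 -> ordinary (kpar w) ->
  [/\ sig 1 w != 0, denj (sfun w) != 0 & jfun w = kj_inv K (kpar w)].
Proof.
move=> w1 w2 /ordinary_nf[g [l [gu nl _ wE]]].
have [c [d [c0 d0 E1 E2]]] := nf_model w1 w2 gu nl wE.
have [s1 sE] := sfun_model gu nl c0 d0.
rewrite -E1 -E2 -surjective_pairing in s1 sE.
have [_ _ _ l3] := nl.
have d0' : denj (sfun w) != 0.
  by rewrite sE /denj mulf_neq0 ?expf_neq0 // normalized_disc.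
split=> //; apply: (mulIf d0'); rewrite /jfun divfK // sE wE.
exact: j_inv_normalized.
Qed.

Lemma near_jfun v : sig 1 v != 0 -> denj (sfun v) != 0 ->
  \forall w \near v, sig 1 w != 0 /\ denj (sfun w) != 0.
Proof.
move=> s1 d0.
have c1 : \forall w \near v, sig 1 w != 0.
  exact: (cvgr_neq0 _ (differentiable_continuous (differentiable_sig 1 v)) s1).
have dd : differentiable (fun w => denj (sfun w)) v.
  under eq_fun do rewrite -horner_denj.
  by apply: differentiable_horner; exact: differentiable_sfun.
have c2 : \forall w \near v, denj (sfun w) != 0.
  exact: (cvgr_neq0 _ (differentiable_continuous dd) d0).
by near=> w; split; near: w.
Unshelve. all: by end_near.
Qed.

Lemma near_neq0 (m n : nat) (f : model -> 'M[K]_(m.+1, n.+1)) v :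
  differentiable f v -> f v != 0 -> \forall w \near v, f w != 0.
Proof.
move=> df f0; exact: (cvgr_neq0 _ (differentiable_continuous df) f0).
Qed.

Lemma near_model_neq0 v : v.1 != 0 -> v.2 != 0 ->
  \forall w \near v, w.1 != 0 /\ w.2 != 0.
Proof.
move=> v1 v2.
have n1 : \forall w \near v, w.1 != 0 
    by apply: (@near_neq0 2 2 fst) => //; exact: differentiable_fst.
have n2 : \forall w \near v, w.2 != 0 
    by apply: (@near_neq0 2 2 snd) => //; exact: differentiable_snd.
by near=> w; split; near: w.
Unshelve. all: by end_near.
Qed.

Lemma holomorphic_j_inv :
  holomorphic (@ordinary K) (kj_base K : set (caffine K)) (kj_inv K).
Proof.
split; first by move=> p /ordinary_nf[g [l []]].
move=> [i1 i2] v [/= v1 v2] Xv; exists tt, jfun.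
have [s1 d0 _] := jfun_ordinary v1 v2 Xv.
near=> w; have [w1 w2] : w.1 != 0 /\ w.2 != 0 by near: w; exact: near_model_neq0.
have [s1w d0w] : sig 1 w != 0 /\ denj (sfun w) != 0 by near: w; exact: near_jfun.
split; first exact: differentiable_jfun.
by move=> Xw; split => //; have [_ _ ->] := jfun_ordinary w1 w2 Xw.
Unshelve. all: by end_near.
Qed.

End JFunction.

Lemma differentiable_col_square (K : numClosedFieldType) (V : normedModType K)
    (f h : V -> 'M[K]_3) (l : V -> 'rV[K]_3) (k : 'I_3) v :
  differentiable f v -> differentiable h v -> differentiable l v ->
  (pencil (f v) (h v))`_1 != 0 -> \det (h v) != 0 -> injective (l v 0) ->
  differentiable (fun x => col_square (f x) (h x) (l x) k) v.
Proof.
move=> df dh dl p1 dh0 linj; rewrite /col_square.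
have dn : differentiable (fun x => norm_ratio (f x) (h x)) v.
  rewrite /norm_ratio; apply: differentiable_scale.
    apply: differentiable_mulr; last first.
      by apply: differentiableV => //; exact: differentiable_coef_pencil.
    apply: differentiable_mulr; first exact: differentiable_cst.
    exact: differentiable_coef_pencil.
  apply: differentiable_mulmx => //; apply: differentiable_scale.
    by apply: differentiableV => //; exact: differentiable_det.
  exact: differentiable_adj.
have dlk j : differentiable (fun x => l x 0 j) v by exact: differentiable_mxE.
have dsub i j : differentiable (fun x => l x 0 i - l x 0 j) v.
  by apply: differentiable_addr => //; exact: differentiable_oppr.
have dfac j : differentiable (fun x => norm_ratio (f x) (h x) - (l x 0 j)%:M) v.
  apply: differentiable_addr => //; apply: differentiable_oppr.
  exact: differentiable_scalar_mx.
apply: differentiable_scale; last first.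
  by apply: differentiable_mulmx => //; exact: differentiable_mulmx.
apply: differentiableV; first exact: differentiable_mulr.
have [/andP[k1 k2] _] := andP (ord3_add k).
by apply: mulf_neq0; rewrite subr_eq0; [apply: contra k1|apply: contra k2] => /eqP/linj <-.
Qed.

Lemma unitmx_col_neq0 (F : fieldType) n (A : 'M[F]_n) : A \in unitmx ->
  forall k, exists i, A i k != 0.
Proof.
move=> Au k; apply: contrapT => nA.
have : A *m (delta_mx k 0 : 'cV_n) = 0.
  rewrite -colE; apply/colP => i; rewrite !mxE; apply/eqP/negPn/negP => Aik.
  by apply: nA; exists i.
move=> /(congr1 (mulmx (invmx A))); rewrite mulKmx // mulmx0 => /matrixP/(_ k 0).
by rewrite !mxE !eqxx => /eqP; rewrite oner_eq0.
Qed.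

(* Near a base point, [esym3 (lam i b)] runs over the four points of the fibre
   of the degree 4 map [numj / denj] over [b], and [lam i b] lists the
   corresponding normalized eigenvalues. *)
Definition eigenvalue_branches (K : numClosedFieldType)
    (lam : 'I_4 -> K -> 'rV[K]_3) (b : K) : Prop :=
  [/\ kj_base K b, forall i, differentiable (lam i) b,
      forall i, normalized (lam i b) /\
        numj (esym3 (lam i b)) = b * denj (esym3 (lam i b)),
      injective (fun i => esym3 (lam i b))
    & forall s, numj s = b * denj s -> exists i, s = esym3 (lam i b)].

(** * The trivialization and its inverse *)

Section Trivialization.
Variable K : numClosedFieldType.
Variables (lam : 'I_4 -> K -> 'rV[K]_3) (U : set K).
Hypothesis Uopen : open U.
Hypothesis lamP : forall b, U b -> eigenvalue_branches lam b.

Definition total : set (kpairs K) := @ordinary K `&` kj_inv K @^-1` U.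

Definition base_fibre : set (cprod (caffine K) (ccopies 4 (ckG_V4 K))) :=
  U `*` kfour_G_V4 K.

(** A coset is a set of points of projective space, from which [xget] picks one. [triv_invE] shows
    that the pick is immaterial: sign changes of the columns leave [nf] unchanged. *)
Definition triv_inv (x : cprod (caffine K) (ccopies 4 (ckG_V4 K))) : kpairs K :=
  nf (prep (xget (pclass 1%:M) (x.2.2 : set (kmx3 K)))) (lam x.2.1 x.1).

Lemma triv_invE b i g : g \in unitmx -> triv_inv (b, (i, kcoset (pclass g))) = nf g (lam i b).
Proof.
move=> gu; rewrite /triv_inv /=; set y := xget _ _.
have : kcoset (pclass g) y.
  apply: xgetPex; exists (pclass g); apply/(kcosetP _ gu).
  exists (const_mx 1); first by move=> k; left; rewrite mxE.
  by rewrite diag_const_mx mulmx1.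
move=> /(kcosetP _ gu)[a sa ->].
have gau : g *m diag_mx a \in unitmx by rewrite unitmx_mul gu diag_signs_unit.
have [c c0 ->] := prep_pclass (unit_mx_neq0 gau).
by rewrite nfZl // nf_signs.
Qed.

Lemma nf_lam_total b i g : U b -> g \in unitmx ->
  total (nf g (lam i b)) /\ kj_inv K (nf g (lam i b)) = b.
Proof.
move=> Ub gu; have [bb _ /(_ i)[nl jl] _ _] := lamP Ub.
by have [Xp jp] := nf_ordinary gu nl bb jl; split=> //; split=> //=; rewrite jp.
Qed.

Lemma total_nf p : total p -> exists i g, g \in unitmx /\ p = nf g (lam i (kj_inv K p)).
Proof.
move=> [/ordinary_nf[g [l [gu nl _ pE]]] Up].
have [_ _ nlam _ surj] := lamP Up.
have [i iE] : exists i, esym3 l = esym3 (lam i (kj_inv K p)).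
  by apply: surj; rewrite {1}pE; exact: j_inv_normalized.
have [g' gu' E] := nf_perm gu nl (nlam i).1 iE.
by exists i, g'; rewrite -E.
Qed.

Lemma triv_inj b i j g h : U b -> g \in unitmx -> h \in unitmx ->
  nf g (lam i b) = nf h (lam j b) -> i = j /\ kcoset (pclass g) = kcoset (pclass h).
Proof.
move=> Ub gu hu E; have [_ _ nlam inj _] := lamP Ub.
have [e3 _] := nf_eq gu hu (nlam i).1 (nlam j).1 E.
have ij := inj _ _ e3; split=> //; rewrite -ij in E.
exact: (nf_coset gu hu (nlam i).1 E).
Qed.

(** [Phi] is obtained by choice as a set-theoretic inverse of [triv_inv], with [kj_inv] as first
    component everywhere. Its holomorphy is deduced later from the last two properties alone. *)
Lemma triv_exists : exists Phi : kpairs K -> cprod (caffine K) (ccopies 4 (ckG_V4 K)),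
  [/\ forall p, (Phi p).1 = kj_inv K p,
      forall p, total p -> base_fibre (Phi p) /\ triv_inv (Phi p) = p
    & forall b i g, U b -> g \in unitmx ->
        Phi (nf g (lam i b)) = (b, (i, kcoset (pclass g)))].
Proof.
have ex p : exists y : 'I_4 * set (kmx3 K), total p ->
    kG_V4 K y.2 /\ triv_inv (kj_inv K p, y) = p.
  have [tp|ntp] := pselect (total p); last by exists (0, set0).
  have [i [g [gu pE]]] := total_nf tp.
  exists (i, kcoset (pclass g)) => _; split; first by apply/kG_V4P; exists g.
  by rewrite triv_invE.
have [f fP] := choice ex.
exists (fun p => (kj_inv K p, f p)); split=> //.
  move=> p tp; have [Gp Ep] := fP p tp; split=> //.
  by split; [exact: tp.2|split].
move=> b i g Ub gu; have [tp jp] := nf_lam_total i Ub gu.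
have [Gp Ep] := fP _ tp; rewrite jp in Ep *; congr (_, _).
case: (f _) Gp Ep => j c /= /kG_V4P[h hu ->]; rewrite triv_invE // => /esym.
by move=> /(triv_inj Ub gu hu)[-> ->].
Qed.

Lemma holomorphic_triv_inv : holomorphic base_fibre total triv_inv.
Proof.
split.
  move=> [b [i c]] [/= Ub [_ /kG_V4P[g gu /= ->]]].
  by rewrite triv_invE //; have [] := nf_lam_total i Ub gu.
move=> [i1 [i i2]] [b g] [/= _ g0] [/= Ub [_ Gg]].
have gu := kG_V4_unit g0 Gg.
exists (tt, tt), (fun w => (diag_form w.2 (lam i w.1), w.2 *m w.2^T)).
have nU : \forall w \near (b, g), U w.1.
  have c : {for (b, g), continuous (fun w : K * 'M[K]_3 => w.1)}.
    by apply: differentiable_continuous; exact: differentiable_fst.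
  by apply: (c U); apply: open_nbhs_nbhs.
have nu : \forall w \near (b, g), \det w.2 != 0.
  have dd : differentiable (fun w : K * 'M[K]_3 => \det w.2) (b, g).
    by apply: differentiable_det; exact: differentiable_snd.
  apply: (cvgr_neq0 _ (differentiable_continuous dd)).
  by rewrite /= -unitfE -unitmxE.
near=> w; have Uw : U w.1 by near: w.
have wu : w.2 \in unitmx by rewrite unitmxE unitfE; near: w.
have [_ dlam nlam _ _] := lamP Uw.
split.
  apply: differentiable_pair; last first.
    apply: differentiable_mulmx; first exact: differentiable_snd.
    by apply: differentiable_trmx; exact: differentiable_snd.
  apply: differentiable_mulmx; last first.
    by apply: differentiable_trmx; exact: differentiable_snd.
  apply: differentiable_mulmx; first exact: differentiable_snd.
  apply: differentiable_mx => u v.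
  have dE : differentiable (fun w : K * 'M[K]_3 => lam i w.1) w.
    exact: (differentiable_comp (differentiable_fst w) (dlam i)).
  rewrite (_ : (fun x => _) =
    fun x : K * 'M[K]_3 => lam i x.1 0 u * (u == v)%:R); last first.
    by apply/funext => x; rewrite mxE mulr_natr.
  apply: differentiable_mulr; last exact: differentiable_cst.
  exact: differentiable_mxE.
move=> _; split.
  split; apply: unit_mx_neq0; last exact: gram_unit.
  exact: (diag_form_unit wu (normalized_neq0 (nlam i).1)).
by rewrite -[RHS]/(triv_inv (w.1, (i, kcoset (pclass w.2)))) triv_invE.
Unshelve. all: by end_near.
Qed.

(** The lift has to produce a matrix [G w] in the coset of [g]. The matrices [col_square] are
    [d g_k g_k^T] for the columns [g_k]; a column of such a matrix, divided by a square root of its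
    diagonal entry, is [g_k] times a square root of [d], an ambiguity that [col_scaling_coset]
    absorbs. *)
Lemma holomorphic_triv Phi :
  (forall p, total p -> base_fibre (Phi p) /\ triv_inv (Phi p) = p) ->
  (forall b i g, U b -> g \in unitmx ->
     Phi (nf g (lam i b)) = (b, (i, kcoset (pclass g)))) ->
  holomorphic total base_fibre Phi.
Proof.
move=> PhiP PhiE; split; first by move=> p /PhiP[].
move=> [i1 i2] v [/= v1 v2] tv.
have [i0 [g0 [g0u vE]]] := total_nf tv.
have [s1v d0v jv] := jfun_ordinary v1 v2 tv.1.
have Ujv : U (jfun v) by rewrite jv; exact: tv.2.
have [_ dlamv nlamv injv _] := lamP Ujv.
rewrite -jv in vE.
have [c0 [d0 [c00 d00 Ev1 Ev2]]] := nf_model v1 v2 g0u (nlamv i0).1 vE.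
have sfv : sfun v = esym3 (lam i0 (jfun v)).
  have [_] := sfun_model g0u (nlamv i0).1 c00 d00.
  by rewrite -Ev1 -Ev2 -surjective_pairing.
(* Column [k] of [g0] is non-zero in row [m k], so the diagonal entry of [S k] whose square root is
   taken does not vanish near [v]. *)
have /choice[m mP] := unitmx_col_neq0 g0u.
pose S k (w : 'M[K]_3 * 'M[K]_3) := col_square w.1 w.2 (lam i0 (jfun w)) k.
have dS w k : sig 1 w != 0 -> denj (sfun w) != 0 -> \det w.2 != 0 -> U (jfun w) ->
    differentiable (S k) w.
  move=> s1 d1 dw Uw; have [_ dlam nlam _ _] := lamP Uw.
  have dl : differentiable (fun w => lam i0 (jfun w)) w.
    exact: (differentiable_comp (differentiable_jfun s1 d1) (dlam i0)).
  have linj : injective (lam i0 (jfun w) 0) by have [[]] := nlam i0.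
  exact: (differentiable_col_square k (differentiable_fst w) (differentiable_snd w)
    dl s1 dw linj).
have det2v : \det v.2 != 0.
  rewrite Ev2 detZ mulf_neq0 ?expf_neq0 // -unitfE -unitmxE; exact: gram_unit.
have Sv k i j : S k v i j = d0 * (g0 i k * g0 j k).
  have [[linj l1 _ _] _] := nlamv i0.
  by rewrite /S Ev1 Ev2 [LHS]col_squareE.
have z0 k : S k v (m k) (m k) != 0 by rewrite Sv !mulf_neq0.
have /choice[q qP] : forall k, exists q : K -> K,
    \forall z \near S k v (m k) (m k), differentiable q z /\ q z ^+ 2 = z.
  by move=> k; exact: sqrt_local.
pose G w : 'M[K]_3 := \matrix_(i, k) (S k w i (m k) / q k (S k w (m k) (m k))).
exists (tt, (i0, tt)), (fun w => (jfun w, G w)).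
have nU : \forall w \near v, U (jfun w).
  have c := differentiable_continuous (differentiable_jfun s1v d0v).
  by apply: (c U); apply: open_nbhs_nbhs.
have ndet : \forall w \near v, \det w.2 != 0.
  have dd : differentiable (fun w : 'M[K]_3 * 'M[K]_3 => \det w.2) v.
    by apply: differentiable_det; exact: differentiable_snd.
  exact: (cvgr_neq0 _ (differentiable_continuous dd)).
have dSv k : differentiable (fun w => S k w (m k) (m k)) v.
  by apply: differentiable_mxE; exact: dS.
have nq : \forall w \near v, forall k, differentiable (q k) (S k w (m k) (m k)) /\
    q k (S k w (m k) (m k)) ^+ 2 = S k w (m k) (m k).
  apply: (@filter_forall _ _ (fun k w => differentiable (q k) (S k w (m k) (m k)) /\
    q k (S k w (m k) (m k)) ^+ 2 = S k w (m k) (m k)) _ (nbhs_filter v)) => k.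
  exact: (differentiable_continuous (dSv k) (qP k)).
have nz : \forall w \near v, forall k, S k w (m k) (m k) != 0.
  apply: (@filter_forall _ _ (fun k w => S k w (m k) (m k) != 0) _ (nbhs_filter v)) => k.
  exact: (cvgr_neq0 _ (differentiable_continuous (dSv k))).
(* Near [v] the value [sfun w] avoids the other three branches, so the sheet index remains [i0]. *)
have ns : \forall w \near v, forall i, i != i0 -> sfun w - esym3 (lam i (jfun w)) != 0.
  apply: (@filter_forall _ _ (fun i w => i != i0 -> sfun w - esym3 (lam i (jfun w)) != 0)
    _ (nbhs_filter v)) => i.
  have [->|ii0] := eqVneq i i0; first by near=> w.
  have dd : differentiable (fun w => sfun w - esym3 (lam i (jfun w))) v.
    apply: differentiable_addr; first exact: differentiable_sfun.
    have dl j : differentiable (fun w => lam i (jfun w) 0 j) v.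
      apply: differentiable_mxE.
      exact: (differentiable_comp (differentiable_jfun s1v d0v) (dlamv i)).
    apply: differentiable_oppr; rewrite /esym3.
    by apply: differentiable_mulr => //; exact: differentiable_mulr.
  have dn : sfun v - esym3 (lam i (jfun v)) != 0.
    rewrite sfv subr_eq0; apply: contra ii0 => /eqP/injv ->; exact: eqxx.
  by apply: filterS (cvgr_neq0 _ (differentiable_continuous dd) dn).
near=> w.
have [w1 w2] : w.1 != 0 /\ w.2 != 0 by near: w; exact: near_model_neq0.
have [s1w d0w] : sig 1 w != 0 /\ denj (sfun w) != 0 by near: w; exact: near_jfun.
have Uw : U (jfun w) by near: w.
have detw : \det w.2 != 0 by near: w.
have qw : forall k, differentiable (q k) (S k w (m k) (m k)) /\
    q k (S k w (m k) (m k)) ^+ 2 = S k w (m k) (m k) by near: w.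
have zw : forall k, S k w (m k) (m k) != 0 by near: w.
have sw : forall i, i != i0 -> sfun w - esym3 (lam i (jfun w)) != 0 by near: w.
have qn0 k : q k (S k w (m k) (m k)) != 0.
  by apply: contraNneq (zw k) => qk0; rewrite -(qw k).2 qk0 expr0n.
have dSw k i j : differentiable (fun w => S k w i j) w.
  exact: (differentiable_mxE i j (dS w k s1w d0w detw Uw)).
split.
  apply: differentiable_pair; first exact: differentiable_jfun.
  apply: differentiable_mx => i k; under eq_fun do rewrite mxE.
  apply: differentiable_mulr => //; apply: differentiableV => //.
  exact: (differentiable_comp (dSw k (m k) (m k)) (qw k).1).
move=> tw; have [_ _ jw] := jfun_ordinary w1 w2 tw.1.
have [i [g [gu wE]]] := total_nf tw; rewrite -jw in wE.
have [_ _ nlam _ _] := lamP Uw.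
have [c [d [cn0 dn0 E1 E2]]] := nf_model w1 w2 gu (nlam i).1 wE.
have ii0 : i = i0.
  apply/eqP; apply: contraT => /sw/negP[]; rewrite subr_eq0; apply/eqP.
  have [_] := sfun_model gu (nlam i).1 cn0 dn0.
  by rewrite -E1 -E2 -surjective_pairing.
rewrite {i}ii0 in wE E1 nlam *.
have Sw k i j : S k w i j = d * (g i k * g j k).
  have [[linj l1 _ _] _] := nlam i0.
  by rewrite /S E1 E2 [LHS]col_squareE.
pose a : 'rV[K]_3 := \row_k (d * g (m k) k / q k (S k w (m k) (m k))).
have GE : G w = g *m diag_mx a.
  by apply/matrixP => u k; rewrite mul_mx_diag [LHS]mxE [RHS]mxE [a 0 k]mxE Sw; ring.
have aE k : a 0 k ^+ 2 = d.
  rewrite [a 0 k]mxE expr_div_n (qw k).2 Sw; have := zw k; rewrite Sw !mulf_eq0 !negb_or.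
  by move=> /and3P[_ gk _]; field; rewrite dn0 gk.
have [Gu Gc] := col_scaling_coset gu dn0 aE; rewrite -GE in Gu Gc.
split; first by split=> //=; exact: unit_mx_neq0.
have PE := PhiE _ i0 _ Uw gu; rewrite -wE in PE.
by apply: etrans (esym PE); rewrite /= Gc.
Unshelve. all: by end_near.
Qed.

End Trivialization.

(** * Charts *)

Lemma diff_near_linear (K : numFieldType) (V W : normedModType K) (f : V -> W)
    (L : {linear V -> W}) z :
  continuous L -> (\forall x \near z, f x = L x) -> 'd f z = L :> (V -> W).
Proof.
move=> Lc fL; apply: diff_unique => //.
apply/eqaddoP => _/posnumP[e].
have fz := nbhs_singleton fL.
have fL' : \forall h \near (0 : V), f (h + z) = L (h + z).
  have c : {for (0 : V), continuous (fun h : V => h + z)}.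
    by apply: differentiable_continuous; apply: differentiable_addr.
  have fL0 : nbhs (0 + z) [set x | f x = L x] by rewrite add0r.
  exact: (c _ fL0).
near=> h.
have E : (f \o shift z - (cst (f z) + L)) h = 0.
  rewrite -[LHS]/(f (h + z) - (f z + L h)) fz.
  have -> : f (h + z) = L (h + z) by near: h.
  by rewrite linearD [L z + L h]addrC subrr.
by rewrite E normr0 mulr_ge0.
Unshelve. all: by end_near.
Qed.

Section Chart.
Variable K : numClosedFieldType.
Variables (k0 l0 : 'I_3) (c0 : K).
Implicit Types (z : 'rV[K]_9) (g : 'M[K]_3) (b : K).

(* Nine coordinates on [K * PGL_3]: the entry [(k0, l0)] of the matrix encoded
   by [z] is the coordinate on the base, since in an affine chart of the
   projective space this entry of the group element is a constant. *)
Definition coord_base z : K := (vec_mx (z : 'rV[K]_(3 * 3)) : 'M[K]_3) k0 l0.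
Definition coord_mx z : 'M[K]_3 := \matrix_(i, j)
  if (i == k0) && (j == l0) then c0 else (vec_mx (z : 'rV[K]_(3 * 3)) : 'M[K]_3) i j.
Definition coord_inv b g : 'rV[K]_9 := mxvec (\matrix_(i < 3, j < 3)
  if (i == k0) && (j == l0) then b else g i j).

Lemma coord_baseK b g : coord_base (coord_inv b g) = b.
Proof. by rewrite /coord_base /coord_inv mxvecK mxE !eqxx. Qed.

Lemma coord_mxK b g : g k0 l0 = c0 -> coord_mx (coord_inv b g) = g.
Proof.
move=> gc; apply/matrixP => i j; rewrite mxE /coord_inv mxvecK mxE.
by case: (eqVneq i k0) => [->|]; case: (eqVneq j l0) => [->|].
Qed.

Lemma coord_mx0 z : coord_mx z k0 l0 = c0.
Proof. by rewrite mxE !eqxx. Qed.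

Lemma coord_invK z : coord_inv (coord_base z) (coord_mx z) = z.
Proof.
rewrite /coord_inv -[RHS](@vec_mxK K 3 3); apply: (congr1 (@mxvec K 3 3)); apply/matrixP => i j.
rewrite [LHS]mxE /coord_mx [X in if _ then _ else X]mxE.
by case: (eqVneq i k0) => [->|]; case: (eqVneq j l0) => [->|].
Qed.

Lemma coord_base_linear : linear coord_base.
Proof. by move=> a x y; rewrite /coord_base linearP !mxE. Qed.

Lemma differentiable_coord_base z : differentiable coord_base z.
Proof.
rewrite (_ : coord_base = fun z : 'rV[K]_9 => z 0 (mxvec_index k0 l0)).
  exact: differentiable_coord.
by apply/funext => x; rewrite /coord_base mxE.
Qed.

Lemma differentiable_coord_mx z : differentiable coord_mx z.
Proof.
apply: differentiable_mx => i j.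
case E : ((i == k0) && (j == l0)).
  rewrite (_ : (fun x => _) = cst c0); first exact: differentiable_cst.
  by apply/funext => x; rewrite mxE E.
rewrite (_ : (fun x => _) = fun z : 'rV[K]_9 => z 0 (mxvec_index i j)).
  exact: differentiable_coord.
by apply/funext => x; rewrite mxE E mxE.
Qed.

Lemma differentiable_coord_inv (V : normedModType K) (f : V -> K) (h : V -> 'M[K]_3) v :
  differentiable f v -> differentiable h v ->
  differentiable (fun x => coord_inv (f x) (h x)) v.
Proof.
move=> df dh; apply: differentiable_mx => i j.
rewrite ord1; case: {j}(@mxvec_indexP 3 3 j) => k l.
rewrite (_ : (fun x => _) = fun x => if (k == k0) && (l == l0) then f x else h x k l).
  by case: (_ && _) => //; exact: differentiable_mxE.
by apply/funext => x; apply: etrans (@mxvecE K 3 3 _ k l) _; rewrite mxE.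
Qed.

End Chart.

(** * A chart of the base times [G / V_4] *)

Section ChartCoset.
Variable K : numClosedFieldType.
Variables (k0 l0 : 'I_3) (g0 : 'M[K]_3) (U : set K) (i0 : 'I_4) (r : 'I_3 -> 'I_3).
Hypothesis Uopen : open U.
Hypothesis g0n : g0 k0 l0 != 0.
Notation c0 := (g0 k0 l0).
Notation cmx := (coord_mx k0 l0 c0).
Notation cbase := (coord_base k0 l0).
Notation fibreK := (cprod (caffine K) (ccopies 4 (ckG_V4 K))).

(** The last condition keeps one entry of each column in a disc that contains no two opposite
    numbers. This selects one sign per column, so that distinct points of the domain stay distinct
    modulo [V_4]. *)
Definition chart_dom : set 'rV[K]_9 :=
  [set z | [/\ U (cbase z), \det (cmx z) != 0
    & forall k, `|cmx z (r k) k - g0 (r k) k| < `|g0 (r k) k|]].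

Definition chart_fun (z : 'rV[K]_9) : fibreK := (cbase z, (i0, kcoset (pclass (cmx z)))).

Definition chart_img : set fibreK := chart_fun @` chart_dom.

Lemma chart_unit z : chart_dom z -> cmx z \in unitmx.
Proof. by move=> [_ d _]; rewrite unitmxE unitfE. Qed.

Lemma near_chart_dom z : chart_dom z -> \forall w \near z, chart_dom w.
Proof.
move=> [Uz dz rz].
have n1 : \forall w \near z, U (cbase w).
  have c := differentiable_continuous (differentiable_coord_base k0 l0 z).
  by apply: (c U); apply: open_nbhs_nbhs.
have n2 : \forall w \near z, \det (cmx w) != 0.
  have dd : differentiable (fun w => \det (cmx w)) z.
    by apply: differentiable_det; exact: differentiable_coord_mx.
  exact: (cvgr_neq0 _ (differentiable_continuous dd)).
have n3 : \forall w \near z, forall k, `|cmx w (r k) k - g0 (r k) k| < `|g0 (r k) k|.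
  apply: (@filter_forall _ _ (fun k w => `|cmx w (r k) k - g0 (r k) k| < `|g0 (r k) k|)
    _ (nbhs_filter z)) => k.
  have dd : differentiable (fun w => cmx w (r k) k - g0 (r k) k) z.
    apply: differentiable_addr; last exact: differentiable_cst.
    by apply: differentiable_mxE; exact: differentiable_coord_mx.
  exact: (cvgr_norm_lt _ (differentiable_continuous dd)).
by near=> w; split; near: w.
Unshelve. all: by end_near.
Qed.

Lemma open_chart_dom : open chart_dom.
Proof. by rewrite openE => z /near_chart_dom. Qed.

Lemma disc_not_opposite (e x y : K) : `|x - e| < `|e| -> `|y - e| < `|e| -> y != - x.
Proof.
move=> xe ye; apply/eqP => yx.
suff h : `|e| + `|e| <= `|x - e| + `|y - e| by rewrite (lt_geF (ltrD xe ye)) in h.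
have E : e *+ 2 = - ((x - e) + (y - e)) by rewrite yx; ring.
by rewrite -mulr2n -normrMn E normrN ler_normD.
Qed.

Lemma chart_inj z z' : chart_dom z -> chart_dom z' -> chart_fun z = chart_fun z' -> z = z'.
Proof.
move=> Wz Wz' [bE /(kcoset_eq (chart_unit Wz) (chart_unit Wz'))[c c00 [a sa mE]]].
have [_ _ rz] := Wz; have [_ _ rz'] := Wz'.
have entry i j : cmx z' i j = c * a 0 j * cmx z i j.
  by rewrite mE mxE mul_mx_diag [in LHS]mxE; ring.
(* The normalized entry fixes the common scalar, so the other columns can change only by a sign,
   which the discs exclude. *)
have ca : c * a 0 l0 = 1.
  by have := entry k0 l0; rewrite !coord_mx0 -{1}[c0]mul1r => /(mulIf g0n).
have cs j : c * a 0 j = 1.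
  have : c * a 0 j = 1 \/ c * a 0 j = -1.
    have c1 : c = a 0 l0.
      by rewrite -[LHS]mulr1 -(signs_sqr sa l0) expr2 mulrA ca mul1r.
    by rewrite c1; case: (sa l0) => ->; case: (sa j) => ->; rewrite ?mul1r ?mulN1r ?opprK; auto.
  case=> // cm; have := disc_not_opposite (rz j) (rz' j).
  by rewrite entry cm mulN1r eqxx.
rewrite -(coord_invK k0 l0 c0 z) -(coord_invK k0 l0 c0 z') bE; congr coord_inv.
by apply/matrixP => i j; rewrite entry cs mul1r.
Qed.

Lemma chart_fun_holomorphic :
  holomorphic (chart_dom : set (caffine 'rV[K]_9)) chart_img chart_fun.
Proof.
split; first by move=> z Wz; exists z.
move=> [] z _ /= Wz; exists (tt, (i0, tt)), (fun z => (cbase z, cmx z)).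
near=> w; have Ww : chart_dom w by near: w; exact: near_chart_dom.
split.
  apply: differentiable_pair; first exact: differentiable_coord_base.
  exact: differentiable_coord_mx.
by move=> _; split=> //; split=> //=; apply: unit_mx_neq0; exact: chart_unit.
Unshelve. all: by end_near.
Qed.

(** The signs [a] found at the base point serve for all nearby points, and dividing by the entry
    [e w] restores the normalization. The same lift yields both the openness of the image and the
    holomorphy of the inverse chart. *)
Lemma chart_img_lift (i : cidx fibreK) v : cdom i v -> chart_img (cpar i v) ->
  exists F : cmodel fibreK -> 'rV[K]_9, \forall w \near v, differentiable F w /\
    [/\ cdom i w, chart_dom (F w) & chart_fun (F w) = cpar i w].
Proof.
case: i v => [[] [i []]] [b g] /= [_ gn0] [z Wz [bE iE zE]].
have zu := chart_unit Wz.
have gu : g \in unitmx.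
  apply: kG_V4_unit => //; rewrite -zE; apply/kG_V4P; by exists (cmx z).
have [c cn0 [a sa mE]] := (kcoset_eq gu zu).1 (esym zE).
pose e (w : K * 'M[K]_3) := (w.2 *m diag_mx a) k0 l0.
have ce : c * e (b, g) = c0.
  by have := coord_mx0 k0 l0 c0 z; rewrite mE mxE.
have en0 : e (b, g) != 0.
  by apply: contraNneq g0n => e0; rewrite -ce e0 mulr0.
pose F (w : K * 'M[K]_3) := coord_inv k0 l0 w.1 ((c0 / e w) *: (w.2 *m diag_mx a)).
have Fmx w : e w != 0 -> cmx (F w) = (c0 / e w) *: (w.2 *m diag_mx a).
  by move=> ew; rewrite coord_mxK // mxE divfK.
have FE : F (b, g) = z.
  rewrite /F -[RHS](coord_invK k0 l0 c0) bE /=; congr coord_inv.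
  by rewrite mE -ce mulfK.
have dm (w : K * 'M[K]_3) : differentiable (fun w : K * 'M[K]_3 => w.2 *m diag_mx a) w.
  by apply: differentiable_mulmx; [exact: differentiable_snd|exact: differentiable_cst].
have de w : differentiable e w by apply: differentiable_mxE; exact: dm.
have dF w : e w != 0 -> differentiable F w.
  move=> ew; apply: differentiable_coord_inv; first exact: differentiable_fst.
  apply: differentiable_scale => //; apply: differentiable_mulr.
    exact: differentiable_cst.
  exact: differentiableV.
exists F.
have ne : \forall w \near (b, g), e w != 0.
  exact: (cvgr_neq0 _ (differentiable_continuous (de (b, g)))).
have nW : \forall w \near (b, g), chart_dom (F w).
  apply: (differentiable_continuous (dF _ en0)); rewrite FE.
  exact: near_chart_dom.
near=> w; have ew : e w != 0 by near: w.
have WF : chart_dom (F w) by near: w.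
have wu : w.2 \in unitmx.
  have := chart_unit WF; rewrite (Fmx _ ew) unitmxE detZ unitrM => /andP[_].
  by rewrite -unitmxE unitmx_mul => /andP[].
split; first exact: dF.
split=> //; first by split=> //; exact: unit_mx_neq0.
rewrite /chart_fun [in LHS]/F coord_baseK -/(F w) iE; congr (_, (_, _)).
have Fu := chart_unit WF; apply/esym/(kcoset_eq wu Fu).
exists (c0 / e w); first by rewrite mulf_neq0 ?invr_eq0.
by exists a => //; exact: Fmx.
Unshelve. all: by end_near.
Qed.

Lemma chart_inverse : exists2 kappa : fibreK -> 'rV[K]_9,
  forall z, chart_dom z -> kappa (chart_fun z) = z &
  holomorphic chart_img (chart_dom : set (caffine 'rV[K]_9)) kappa.
Proof.
have /choice[kappa kP] : forall y, exists z, chart_img y -> chart_dom z /\ chart_fun z = y.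
  move=> y; have [[z Wz zy]|ny] := pselect (chart_img y); first by exists z.
  by exists 0.
have kK z : chart_dom z -> kappa (chart_fun z) = z.
  move=> Wz; have [Wk kE] := kP _ (ex_intro2 _ _ z Wz erefl).
  exact: chart_inj.
exists kappa => //; split; first by move=> y /kP[].
move=> i v iv Tv; have [F HF] := chart_img_lift iv Tv.
exists tt, F; apply: filterS HF => w [dF [_ WF EF]]; split=> // _; split=> //.
by rewrite -EF kK.
Qed.

Lemma near_chart_img (i : cidx fibreK) v : cdom i v -> chart_img (cpar i v) ->
  \forall w \near v, chart_img (cpar i w).
Proof.
move=> iv Tv; have [F HF] := chart_img_lift iv Tv.
by apply: filterS HF => w [_ [_ WF <-]]; exists (F w).
Qed.

Lemma chart_img_fibre : chart_img `<=` base_fibre U.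
Proof.
move=> _ [z Wz <-]; have [Uz _ _] := Wz; split=> //; split=> //.
by apply/kG_V4P; exists (cmx z) => //; exact: chart_unit.
Qed.

End ChartCoset.

(** * The bundle and the submersion *)

Section Main.
Variable K : numClosedFieldType.
Implicit Types (p : kpairs K) (b : K).

Lemma trivializing b0 : kj_base K b0 ->
  exists (lam : 'I_4 -> K -> 'rV[K]_3) (U : set K), [/\ open U, U b0
    & forall b, U b -> eigenvalue_branches lam b].
Proof.
move=> [b00 b01]; have [lam lamP] := lam_branches b00 b01.
have nb : \forall b \near b0, kj_base K b.
  by near=> b; split; near: b; exact: near_neq.
pose good b := kj_base K b /\ [/\ forall i, differentiable (lam i) b,
        forall i, injective (lam i b 0),
        forall i, [/\ esym1 (lam i b) = 2, esym2 (lam i b) = 1,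
          esym3 (lam i b) != 0
          & numj (esym3 (lam i b)) = b * denj (esym3 (lam i b))],
        injective (fun i => esym3 (lam i b))
      & forall s, numj s = b * denj s -> exists i, s = esym3 (lam i b)].
exists lam, (interior [set b | good b]); split; first exact: open_interior.
  by near=> b; split; near: b.
move=> b /interior_subset[bb [h1 h2 h3 h4 h5]]; split=> // i.
by have [e1 e2 e3 e4] := h3 i.
Unshelve. all: by end_near.
Qed.

Lemma triv_biholomorphic lam U Phi : open U ->
  (forall b, U b -> eigenvalue_branches lam b) ->
  (forall p, total U p -> base_fibre U (Phi p) /\ triv_inv lam (Phi p) = p) ->
  (forall b i g, U b -> g \in unitmx ->
     Phi (nf g (lam i b)) = (b, (i, kcoset (pclass g)))) ->
  biholomorphic (total U) (base_fibre U) Phi.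
Proof.
move=> Uo lamP PhiP PhiE; exists (triv_inv lam); split.
- exact: (holomorphic_triv Uo lamP PhiP PhiE).
- exact: (holomorphic_triv_inv Uo lamP).
- by move=> p /PhiP[].
- move=> [b [i c]] [/= Ub [_ /kG_V4P[g gu /= ->]]].
  by rewrite triv_invE // PhiE.
Qed.

Lemma kfiber_bundle :
  fiber_bundle (@ordinary K) (kj_base K) (kfour_G_V4 K) (kj_inv K).
Proof.
split; first by move=> p /ordinary_nf[g [l []]].
move=> b0 bb0; have [lam [U [Uo Ub0 lamP]]] := trivializing bb0.
have [Phi [Phi1 PhiP PhiE]] := triv_exists lamP.
exists U, Phi; split.
- exact: Uo.
- exact: Ub0.
- by move=> b /lamP[bb _ _ _ _]; exact: bb.
- exact: (triv_biholomorphic Uo lamP PhiP PhiE).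
- by move=> x _ _; exact: Phi1.
Qed.

Lemma kj_inv_surj : set_surj (@ordinary K) (kj_base K) (kj_inv K).
Proof.
move=> b bb; have [lam [U [Uo Ub lamP]]] := trivializing bb.
have [tp jp] := nf_lam_total lamP 0 Ub (unitmx1 K 3).
by exists (nf 1%:M (lam 0 b)); [exact: tp.1|].
Qed.

Lemma kpar_scale (c d : K) (w : 'M[K]_3 * 'M[K]_3) : c != 0 -> d != 0 ->
  kpar (c *: w.1, d *: w.2) = kpar w.
Proof. by move=> c0 d0; rewrite /kpar !pclassZ. Qed.

Lemma near_scale (Q : kpairs K -> Prop) (c d : K) (v v' : 'M[K]_3 * 'M[K]_3) :
  c != 0 -> d != 0 -> v.1 = c *: v'.1 -> v.2 = d *: v'.2 ->
  (\forall w \near v, Q (kpar w)) -> \forall w \near v', Q (kpar w).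
Proof.
move=> c0 d0 E1 E2 Qv.
pose s (w : 'M[K]_3 * 'M[K]_3) : 'M[K]_3 * 'M[K]_3 := (c *: w.1, d *: w.2).
have ds w : differentiable s w.
  apply: differentiable_pair; apply: differentiable_scale;
    by [exact: differentiable_cst|exact: differentiable_fst|exact: differentiable_snd].
have sE : s v' = v by rewrite /s -E1 -E2 -surjective_pairing.
have Qs : nbhs (s v') [set w | Q (kpar w)] by rewrite sE.
have nQ : \forall w \near v', Q (kpar (s w)).
  exact: (differentiable_continuous (ds v') Qs).
near=> w; have : Q (kpar (s w)) by near: w.
by rewrite kpar_scale.
Unshelve. all: by end_near.
Qed.

(** The interior of [Q] for the quotient topology, tested at the representatives given by [prep]; by
    [near_scale] any other representatives give the same set. *)
Definition near_pairs (Q : kpairs K -> Prop) : set (kpairs K) :=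
  [set p | \forall w \near ((prep p.1, prep p.2) : 'M[K]_3 * 'M[K]_3), Q (kpar w)].

Lemma kpar_prep p : kpar (prep p.1, prep p.2) = p.
Proof. by rewrite /kpar !prepK; case: (p). Qed.

Lemma near_pairs_sub Q : near_pairs Q `<=` [set p | Q p].
Proof. by move=> p /nbhs_singleton; rewrite kpar_prep. Qed.

Lemma near_pairsE Q v : v.1 != 0 -> v.2 != 0 ->
  near_pairs Q (kpar v) <-> \forall w \near v, Q (kpar w).
Proof.
move=> v1 v2; have [c c0 cE] := prep_pclass v1; have [d d0 dE] := prep_pclass v2.
rewrite /near_pairs /=; split; first exact: (near_scale c0 d0).
have ci : c^-1 != 0 by rewrite invr_eq0.
have di : d^-1 != 0 by rewrite invr_eq0.
by apply: (near_scale ci di) => /=; rewrite ?cE ?dE scalerA mulVf // scale1r.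
Qed.

Lemma copen_near_pairs Q : copen (near_pairs Q).
Proof.
move=> [[] []]; rewrite openE => v [[/= v1 v2]] /(near_pairsE _ v1 v2) Qv.
have Qvv : \forall w \near v, \forall x \near w, Q (kpar x) by exact: (near_join Qv).
near=> w; have [w1 w2] : w.1 != 0 /\ w.2 != 0 by near: w; exact: near_model_neq0.
by split=> //; apply/(near_pairsE _ w1 w2); near: w.
Unshelve. all: by end_near.
Qed.

(** Composing the inverse trivialization with a chart of the base times [G / V_4] gives a chart of
    the Cayley set in which [j] is one of the nine coordinates, so that its differential is visibly
    surjective. *)
Lemma kj_submersion : submersion 9 (@ordinary K) (kj_base K) (kj_inv K).
Proof.
split; first exact: holomorphic_j_inv.
move=> p Xp; have [j0 j1] : kj_base K (kj_inv K p).
  by have /ordinary_nf[g [l []]] := Xp.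
have [lam [U [Uo Up lamP]]] := trivializing (conj j0 j1).
have [Phi [Phi1 PhiP PhiE]] := triv_exists lamP.
have tp : total U p by [].
have [i0 [g0 [g0u pE]]] := total_nf lamP tp.
have /choice[r rP] := unitmx_col_neq0 g0u.
pose k0 := r 0; have g0n : g0 k0 0 != 0 := rP 0.
pose W := chart_dom k0 0 g0 U r; pose iota := chart_fun k0 0 g0 i0.
have Wopen : open W by exact: open_chart_dom.
have [kappa kK kh] := chart_inverse i0 r Uo g0n.
pose psi := triv_inv lam \o iota.
pose T := chart_img k0 0 g0 U i0 r.
have TB : T `<=` base_fibre U by exact: chart_img_fibre.
have psiE z : W z -> psi z = nf (coord_mx k0 0 (g0 k0 0) z) (lam i0 (coord_base k0 0 z)).
  by move=> Wz; rewrite /psi /= triv_invE // (chart_unit Wz).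
have psi_total z : W z -> total U (psi z) /\ kj_inv K (psi z) = coord_base k0 0 z.
  by move=> Wz; rewrite psiE //; apply: nf_lam_total => //; [have [] := Wz|exact: chart_unit Wz].
have Phi_psi z : W z -> Phi (psi z) = iota z.
  by move=> Wz; rewrite psiE // PhiE //; [have [] := Wz|exact: chart_unit Wz].
(* The open set of the chart is the interior of this condition. It cuts out of the ordinary pairs
   exactly the image of [W], once this image is known to be relatively open, which is [psi_near]. *)
pose Q q := ordinary q -> exists2 z, W z & psi z = q.
pose z0 := coord_inv k0 0 (kj_inv K p) g0.
have Gz0 : coord_mx k0 0 (g0 k0 0) z0 = g0 by rewrite coord_mxK.
have Wz0 : W z0.
  split; rewrite ?Gz0 ?coord_baseK //; first by rewrite -unitfE -unitmxE.
  by move=> k; rewrite subrr normr0 normr_gt0.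
have psiz0 : psi z0 = p by rewrite psiE // Gz0 coord_baseK -pE.
have sub_total : @ordinary K `&` near_pairs Q `<=` total U.
  by move=> q [Xq /near_pairs_sub /(_ Xq)[z Wz <-]]; have [] := psi_total _ Wz.
have Phi_T q : (@ordinary K `&` near_pairs Q) q -> T (Phi q).
  by move=> [Xq /near_pairs_sub /(_ Xq)[z Wz <-]]; rewrite Phi_psi //; exists z.
have psi_near z : W z -> near_pairs Q (psi z).
  move=> Wz; have [tz jz] := psi_total _ Wz.
  set q := psi z in tz jz *; pose v := (prep q.1, prep q.2).
  have qv : kpar v = q by exact: kpar_prep.
  have v1 : v.1 != 0 by exact: prep_neq0.
  have v2 : v.2 != 0 by exact: prep_neq0.
  have [_ hPhi] := holomorphic_triv Uo lamP PhiP PhiE.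
  have tv : total U (kpar v) by rewrite qv.
  have [i' [F HF]] := hPhi (tt, tt) v (conj v1 v2) tv.
  have [dFv /(_ tv)[i'F EF]] := nbhs_singleton HF.
  have nF : \forall w \near v, total U (kpar w) -> cpar i' (F w) = Phi (kpar w).
    by apply: filterS HF => w [_ h] /h[].
  have TF : T (cpar i' (F v)).
    rewrite EF; change (T (Phi (kpar v))); rewrite qv /q Phi_psi //; by exists z.
  (* Openness of the chart image, pulled back along the continuous lift [F] of [Phi]. *)
  have nT : \forall w \near v, T (cpar i' (F w)).
    exact: (differentiable_continuous dFv (near_chart_img Uo g0n i'F TF)).
  have [s1 d0 jv] := jfun_ordinary v1 v2 tv.1.
  have nU : \forall w \near v, U (jfun w).
    have Uv : nbhs (jfun v) U.
      by apply: open_nbhs_nbhs; split => //; rewrite jv; exact: tv.2.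
    exact: (differentiable_continuous (differentiable_jfun s1 d0) Uv).
  change (\forall w \near v, Q (kpar w)).
  near=> w; have [w1 w2] : w.1 != 0 /\ w.2 != 0 by near: w; exact: near_model_neq0.
  move=> Xw; have [_ _ jw] := jfun_ordinary w1 w2 Xw.
  have tw : total U (kpar w) by split=> //=; rewrite -jw; near: w.
  have Ew : cpar i' (F w) = Phi (kpar w).
    have h : total U (kpar w) -> cpar i' (F w) = Phi (kpar w) by near: w.
    exact: h.
  have [z' Wz' zE] : T (Phi (kpar w)) by rewrite -Ew; near: w.
  exists z'; first exact: Wz'.
  exact: etrans (congr1 (triv_inv lam) zE) (PhiP _ tw).2.
exists (near_pairs Q), W, psi, z0; split.
- by split; [exact: copen_near_pairs|].
- by [].
- exists (kappa \o Phi); split.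
  + have h : holomorphic (W : set (caffine 'rV[K]_9)) (total U) psi.
      apply: (holomorphic_comp _ (holomorphic_triv_inv Uo lamP)).
      apply: (holomorphic_sub _ _ (chart_fun_holomorphic k0 0 g0 i0 r Uo)) => //.
      by move=> z Wz; apply: TB; exists z.
    apply: (holomorphic_sub _ _ h) => // z Wz; split; last exact: psi_near.
    by have [[]] := psi_total _ Wz.
  + apply: holomorphic_comp kh.
    apply: (holomorphic_sub _ _ (holomorphic_triv Uo lamP PhiP PhiE)) => //.
  + by move=> z Wz /=; rewrite Phi_psi // kK.
  + move=> q oq /=; have [z Wz zE] := Phi_T _ oq.
    have kE : kappa (Phi q) = z by rewrite -zE; exact: kK.
    rewrite kE; exact: etrans (congr1 (triv_inv lam) zE) (PhiP _ (sub_total _ oq)).2.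
(* On [W], [j] composed with [psi] is the linear coordinate [coord_base]; the tangent vector with
   [u] in that slot and zeros elsewhere is sent to [u]. *)
- move=> u; exists (coord_inv k0 0 u 0).
  pose cbM := GRing.isLinear.Build _ _ _ _ _ (@coord_base_linear K k0 0).
  pose L : {linear 'rV[K]_9 -> K} := HB.pack (coord_base (K := K) k0 0) cbM.
  have Lc : continuous L.
    by move=> z; apply: differentiable_continuous; exact: differentiable_coord_base.
  have nW : \forall z \near z0, (kj_inv K \o psi) z = L z.
    near=> z; have Wz : W z by near: z; exact: near_chart_dom.
    by have [_] := psi_total _ Wz.
  by rewrite (diff_near_linear Lc nW); exact: coord_baseK.
Unshelve. all: by end_near.
Qed.

Lemma theorem5_closed :
  [/\ kspecial K = ktransverse K `&` korbit K @^-1` kspecial_moduli K,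
      submersion 9 (kcayley K `\` kspecial K) (kj_base K) (kj_inv K)
      /\ set_surj (kcayley K `\` kspecial K) (kj_base K) (kj_inv K)
    & fiber_bundle (kcayley K `\` kspecial K) (kj_base K)
        (kfour_G_V4 K) (kj_inv K)].
Proof.
split; first exact: kspecialE; last exact: kfiber_bundle.
by split; [exact: kj_submersion|exact: kj_inv_surj].
Qed.

End Main.

Theorem theorem5 (R : realType) :
  [/\ special_pairs R
        = transverse_pairs R `&` orbit_of R @^-1` special_moduli R,
      submersion 9 (cayley_set R `\` special_pairs R) (j_base R) (j_inv R)
      /\ set_surj (cayley_set R `\` special_pairs R) (j_base R) (j_inv R)
    & fiber_bundle (cayley_set R `\` special_pairs R) (j_base R)
        (four_G_V4 R) (j_inv R)].
Proof. exact: (theorem5_closed R[i]). Qed.
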